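(* Let $k\ge 0$ be an integer, $p>2\max\{k\}+1$, $q>-1$ and $\upsilon=1,2,\dots$. The bivariate Laplace transform (with transform variables $a,b$ corresponding to $y,z$) of the finite bivariate M-Konhauser polynomials is given by $$\mathcal{L}_2\left\{y^{q}z^{-p-q}\;{}_{K}M_{k;\upsilon}^{(p,q)}(w_1y,w_2z)\right\}=\frac{\Gamma(k+q+1)}{a^{q+1}b^{1-p-q}}\left(\frac{w_2^{\upsilon}-b^{\upsilon}}{b^{\upsilon}}\right)^{k}{}_2F_0\!\left[-k,k+1-p;-;\frac{w_1b^{\upsilon}}{a\,(w_2^{\upsilon}-b^{\upsilon})}\right].$$
   Context: $(a)_n=a(a+1)\cdots(a+n-1)$, $(a)_0=1$, and ${}_2F_0[-k,\beta;-;x]=\sum_{l=0}^{k}\frac{(-k)_l(\beta)_l}{l!}x^l$. The two-dimensional Laplace transform is $\mathcal{L}_2[f(y,z)](\zeta,\kappa)=\int_0^\infty\int_0^\infty e^{-(\zeta y+\kappa z)}f(y,z)\,dy\,dz$, $\mathrm{Re}(\zeta),\mathrm{Re}(\kappa)>0$, here evaluated at $(\zeta,\kappa)=(a,b)$. For $p>2\max\{k\}+1$ (with $\max\{k\}$ the largest degree $k$ considered), $q>-1$ and $\upsilon=1,2,\dots$, the finite bivariate M-Konhauser polynomials are $${}_{K}M_{k;\upsilon}^{(p,q)}(y,z)=(-1)^k\Gamma(k+q+1)\sum_{l=0}^{k}\sum_{s=0}^{k-l}\frac{(-k)_{l+s}(k+1-p)_l(-y)^l z^{\upsilon s}}{\Gamma(l+q+1)\Gamma(\upsilon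 s-p-q+1)\,l!\,s!}.$$
   Formalization: The z-integral, which diverges at 0 for k ≥ 1 and non-integer p+q, is read as a Hadamard finite part; for integer p+q (Gamma poles in the polynomial) the formula is stated as a limit of transforms for p' → p; w_2^υ ≠ b^υ is assumed so that the right side is defined. *)

(* Defs.v *)
(* Stdlib world: Stdlib reals with Coquelicot. *)
From Stdlib Require Import Reals ZArith Lra Lia.
From Coquelicot Require Import Coquelicot.
Open Scope R_scope.

(* Euler's integral on x > 0, continued to the other non-poles by
   Gamma x = Gamma (x + n) / (x)_n, n being the least natural number with
   x + n > 0 (n = 0 when x > 0).  The poles 0, -1, -2, ... get a junk value. *)

Definition Gamma_pos (x : R) : R :=
  RInt_gen (fun t => Rpower t (x - 1) * exp (- t)) (at_right 0) (Rbar_locally p_infty).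

Fixpoint poch (x : R) (n : nat) : R :=
  match n with
  | O => 1
  | S m => poch x m * (x + INR m)
  end.

Definition Gamma_shift (x : R) : nat := Z.to_nat (up (- x)).

Definition Gamma (x : R) : R :=
  Gamma_pos (x + INR (Gamma_shift x)) / poch x (Gamma_shift x).

Definition Cexp (c : C) : C :=
  (RtoC (exp (Re c)) * (cos (Im c), sin (Im c)))%C.

(* Principal branch of c^x; only meant for Re c > 0, where the principal
   argument of c is atan (Im c / Re c). *)
Definition Cpower (c : C) (x : R) : C :=
  let theta := atan (Im c / Re c) in
  (RtoC (Rpower (Cmod c) x) * (cos (x * theta), sin (x * theta)))%C.

Definition hyp2F0 (k : nat) (beta : R) (x : C) : C :=
  sum_n (fun l => (RtoC (poch (- INR k) l * poch beta l / INR (fact l)) * x ^ l)%C) k.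

Definition KM (k v : nat) (p q : R) (y z : C) : C :=
  (RtoC ((-1) ^ k * Gamma (INR k + q + 1)) *
   sum_n (fun l =>
     sum_n (fun s =>
       RtoC (poch (- INR k) (l + s) * poch (INR k + 1 - p) l /
             (Gamma (INR l + q + 1) * Gamma (INR (v * s) - p - q + 1)
              * INR (fact l) * INR (fact s)))
       * (- y) ^ l * z ^ (v * s))
     (k - l)) k)%C.

(* Hadamard finite part at 0+: J(e) minus a combination of the divergent
   scales e^(-lam), lam > 0, and ln e tends to A.  If J converges at 0+ this is
   its limit. *)
Definition is_finite_part (J : R -> C) (A : C) : Prop :=
  exists (n : nat) (lam : nat -> R) (c : nat -> C) (d : C),
    (forall j, (j <= n)%nat -> 0 < lam j) /\
    filterlim
      (fun e => (J e - sum_n (fun j => c j * RtoC (Rpower e (- lam j))) n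
                 - d * RtoC (ln e))%C)
      (at_right 0) (locally A).

(* The double Laplace integral of f at (a, b) has value A.  The z-integral is
   taken in the sense of Hadamard's finite part at z = 0, so this is the
   ordinary iterated improper integral whenever the latter converges.  For
   f(y,z) = y^q z^(-p-q) KM(w1 y, w2 z) with p > 2k+1 the finite part cannot be
   avoided: as soon as k >= 1 one has p + q > 2 and the ordinary integral
   diverges at z = 0 when p + q is not an integer. *)
Definition is_laplace2 (f : R -> R -> C) (a b A : C) : Prop :=
  exists (I J : R -> C),
    (forall z, 0 < z ->
       is_RInt_gen (V := C_R_NormedModule)
         (fun y => Cexp (- (a * RtoC y + b * RtoC z)) * f y z)%C
         (at_right 0) (Rbar_locally p_infty) (I z)) /\
    (forall e, 0 < e ->
       is_RInt_gen (V := C_R_NormedModule) I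
         (at_point e) (Rbar_locally p_infty) (J e)) /\
    is_finite_part J A.

Lemma at_right0_half : filterlim (fun e => / 2 * e) (at_right 0) (at_right 0).
Proof.
intros P [d Hd].
assert (Hd2 : 0 < 2 * d) by (pose proof (cond_pos d); lra).
exists (mkposreal _ Hd2); intros e He He0; apply Hd; [|lra].
change (Rabs (e - 0) < 2 * d) in He; change (Rabs (/ 2 * e - 0) < d).
rewrite Rminus_0_r in *; rewrite Rabs_pos_eq in * by lra; lra.
Qed.

Lemma lim_half (g : R -> R) (A m : R) :
  filterlim g (at_right 0) (locally A) ->
  filterlim (fun e => g (/ 2 * e) - m * g e) (at_right 0) (locally (A - m * A)).
Proof.
intros Hg.
assert (H1 : filterlim (fun e => g (/ 2 * e)) (at_right 0) (locally A))
  by (eapply filterlim_comp; [exact at_right0_half | exact Hg]).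
assert (H2 : filterlim (fun e => - m * g e) (at_right 0) (locally (- m * A)))
  by (eapply filterlim_comp; [exact Hg | apply (filterlim_scal_r (K := R_AbsRing) (V := R_NormedModule))]).
replace (A - m * A) with (plus A (- m * A)) by (unfold plus; simpl; ring).
eapply filterlim_ext;
  [ | exact (filterlim_comp_2 _ _ _ H1 H2 (filterlim_plus (K := R_AbsRing) (V := R_NormedModule) A (- m * A)))].
intros e; unfold plus; simpl; ring.
Qed.

Lemma lim_const_at_right (K A : R) :
  filterlim (fun _ : R => K) (at_right 0) (locally A) -> A = K.
Proof.
intros H.
exact (filterlim_locally_unique (K := R_AbsRing) (V := R_NormedModule) _ A K H
         (filterlim_const K)).
Qed.

Lemma Rpower_half (e lam : R) : 0 < e ->
  Rpower (/ 2 * e) (- lam) = Rpower 2 lam * Rpower e (- lam).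
Proof.
intros He; rewrite <- Rpower_mult_distr by lra.
f_equal; unfold Rpower; rewrite ln_Rinv by lra; f_equal; ring.
Qed.

Lemma power_scales (lam : nat -> R) (n : nat) : forall (c : nat -> R) (K A : R),
  (forall j, (j <= n)%nat -> 0 < lam j) ->
  filterlim (fun e => sum_n (fun j => c j * Rpower e (- lam j)) n + K)
    (at_right 0) (locally A) -> A = K.
Proof.
assert (Hmu : forall x, 0 < x -> 1 < Rpower 2 x).
{ intros x Hx; rewrite <- (Rpower_O 2) by lra; apply Rpower_lt; lra. }
assert (Hpos : forall P : R -> Prop, (forall e, 0 < e -> P e) -> at_right 0 P).
{ intros P HP; exists (mkposreal 1 Rlt_0_1); intros e _; apply HP. }
induction n as [|n IH]; intros c K A Hl Hg.
- specialize (Hmu _ (Hl 0%nat (le_n _))); set (m := Rpower 2 (lam 0%nat)) in *.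
  apply (lim_half _ _ m) in Hg.
  assert (E : A - m * A = K - m * K); [|nra].
  apply lim_const_at_right; revert Hg; apply filterlim_ext_loc, Hpos; intros e He.
  rewrite !sum_O, Rpower_half by exact He; fold m; ring.
- specialize (Hmu _ (Hl (S n) (le_n _))); set (m := Rpower 2 (lam (S n))) in *.
  apply (lim_half _ _ m) in Hg.
  assert (E : A - m * A = K - m * K); [|nra].
  apply (IH (fun j => (Rpower 2 (lam j) - m) * c j)); [intros j Hj; apply Hl; lia|].
  revert Hg; apply filterlim_ext_loc, Hpos; intros e He.
  rewrite !sum_Sn; unfold plus; simpl.
  rewrite (Rpower_half e (lam (S n))) by exact He; fold m.
  assert (E : forall N,
    sum_n (fun j => c j * Rpower (/ 2 * e) (- lam j)) N
    - m * sum_n (fun j => c j * Rpower e (- lam j)) N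
    = sum_n (fun j => (Rpower 2 (lam j) - m) * c j * Rpower e (- lam j)) N).
  { induction N as [|N IHN]; [rewrite !sum_O | rewrite !sum_Sn; unfold plus; simpl; rewrite <- IHN];
      rewrite Rpower_half by exact He; ring. }
  rewrite <- E; ring.
Qed.

Lemma power_log_scales (lam : nat -> R) (n : nat) (c : nat -> R) (d A : R) :
  (forall j, (j <= n)%nat -> 0 < lam j) ->
  filterlim (fun e => sum_n (fun j => c j * Rpower e (- lam j)) n + d * ln e)
    (at_right 0) (locally A) -> A = 0.
Proof.
intros Hl Hg.
assert (Hpos : forall P : R -> Prop, (forall e, 0 < e -> P e) -> at_right 0 P).
{ intros P HP; exists (mkposreal 1 Rlt_0_1); intros e _; apply HP. }
assert (Hd : A - 1 * A = - d * ln 2).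
{ apply (power_scales lam n (fun j => (Rpower 2 (lam j) - 1) * c j)); [exact Hl|].
  generalize (lim_half _ _ 1 Hg); apply filterlim_ext_loc, Hpos; intros e He.
  rewrite ln_mult, ln_Rinv by lra.
  assert (E : forall N,
    sum_n (fun j => c j * Rpower (/ 2 * e) (- lam j)) N
    - sum_n (fun j => c j * Rpower e (- lam j)) N
    = sum_n (fun j => (Rpower 2 (lam j) - 1) * c j * Rpower e (- lam j)) N).
  { induction N as [|N IHN]; [rewrite !sum_O | rewrite !sum_Sn; unfold plus; simpl; rewrite <- IHN];
      rewrite Rpower_half by exact He; ring. }
  rewrite <- E; ring. }
assert (Hd0 : d = 0) by (pose proof ln_lt_2; nra).
apply (power_scales lam n c); [exact Hl|].
revert Hg; apply filterlim_ext; intros e; rewrite Hd0; ring.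
Qed.

Lemma is_finite_part_unique (J : R -> C) (A B : C) :
  is_finite_part J A -> is_finite_part J B -> A = B.
Proof.
intros (n & lam & c & d & Hl & HJ) (n' & lam' & c' & d' & Hl' & HJ').
assert (main : forall pr : C -> R,
  (forall x y : C, pr (x + y)%C = pr x + pr y) ->
  (forall (x : C) (r : R), pr (x * RtoC r)%C = pr x * r) ->
  (forall x : C, filterlim pr (locally x) (locally (pr x))) ->
  pr A = pr B).
{ intros pr prD prM prc.
  assert (prB : forall x y, pr (x - y)%C = pr x - pr y).
  { intros x y; replace (x - y)%C with (x + y * RtoC (-1))%C by ring.
    rewrite prD, prM; ring. }
  assert (prS : forall (u : nat -> C) N, pr (sum_n u N) = sum_n (fun j => pr (u j)) N).
  { intros u N; induction N as [|N IHN]; [now rewrite !sum_O|].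
    rewrite !sum_Sn, <- IHN; apply prD. }
  pose proof (filterlim_comp _ _ _ _ _ _ _ _ HJ (prc A)) as H1.
  pose proof (filterlim_comp _ _ _ _ _ _ _ _ HJ' (prc B)) as H2.
  assert (H2' : filterlim (fun e => - 1 * pr (J e - sum_n (fun j => c' j * RtoC (Rpower e (- lam' j))) n'
                 - d' * RtoC (ln e))%C) (at_right 0) (locally (- 1 * pr B)))
    by (eapply filterlim_comp; [exact H2 | apply (filterlim_scal_r (K := R_AbsRing) (V := R_NormedModule))]).
  pose proof (filterlim_comp_2 _ _ _ H1 H2'
    (filterlim_plus (K := R_AbsRing) (V := R_NormedModule) (pr A) (- 1 * pr B))) as H3.
  assert (E : plus (pr A) (- 1 * pr B) = 0); [|unfold plus in E; simpl in E; lra].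
  apply (power_log_scales
    (fun j => if Nat.leb j n then lam j else lam' (j - S n)%nat) (S n + n')
    (fun j => if Nat.leb j n then - pr (c j) else pr (c' (j - S n)%nat))
    (pr d' - pr d)).
  - intros j Hj; destruct (Nat.leb_spec j n); [now apply Hl | apply Hl'; lia].
  - revert H3; apply filterlim_ext; intros e.
    rewrite !prB, !prS, !prM.
    unfold sum_n at 3; rewrite (sum_n_m_Chasles _ 0 n (S n + n')) by lia.
    rewrite (sum_n_m_ext_loc _ (fun j => (-1) * pr (c j * RtoC (Rpower e (- lam j)))%C) 0 n).
    2:{ intros j Hj; destruct (Nat.leb_spec j n); [|lia]; rewrite prM; simpl; ring. }
    assert (Es : sum_n_m (fun j => (if Nat.leb j n then - pr (c j) else pr (c' (j - S n)%nat)) *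
       Rpower e (- (if Nat.leb j n then lam j else lam' (j - S n)%nat))) (S n) (S n + n')
       = sum_n (fun j => pr (c' j * RtoC (Rpower e (- lam' j)))%C) n').
    { clear - prM. induction n' as [|N IHN].
      - rewrite Nat.add_0_r, sum_n_n, sum_O.
        destruct (Nat.leb_spec (S n) n); [lia|]; rewrite Nat.sub_diag; symmetry; apply prM.
      - rewrite Nat.add_succ_r, sum_n_Sm, sum_Sn, IHN by lia; f_equal.
        destruct (Nat.leb_spec (S (S n + N)) n); [lia|].
        replace (S (S n + N) - S n)%nat with (S N) by lia; symmetry; apply prM. }
    rewrite Es; unfold plus; simpl.
    set (u := fun j => pr (c j * RtoC (Rpower e (- lam j)))%C).
    assert (Em : sum_n_m (fun j => (-1) * u j) 0 n = (-1) * sum_n u n)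
      by exact (sum_n_m_mult_l (K := R_Ring) (-1) u 0 n).
    unfold u in Em; rewrite Em; unfold u; ring. }
rewrite (surjective_pairing A), (surjective_pairing B); f_equal; apply (main).
- reflexivity.
- intros [x1 x2] r; simpl; ring.
- intros [x1 x2] P [eps HP]; exists eps; intros [y1 y2] [Hy _]; now apply HP.
- reflexivity.
- intros [x1 x2] r; simpl; ring.
- intros [x1 x2] P [eps HP]; exists eps; intros [y1 y2] [_ Hy]; now apply HP.
Qed.

Lemma is_laplace2_unique (f : R -> R -> C) (a b A B : C) :
  is_laplace2 f a b A -> is_laplace2 f a b B -> A = B.
Proof.
intros (I1 & J1 & HI1 & HJ1 & HA) (I2 & J2 & HI2 & HJ2 & HB).
assert (EI : forall z, 0 < z -> I1 z = I2 z).
{ intros z Hz; rewrite <- (is_RInt_gen_unique (V := C_R_CompleteNormedModule) _ _ (HI1 z Hz)).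
  exact (is_RInt_gen_unique (V := C_R_CompleteNormedModule) _ _ (HI2 z Hz)). }
assert (EJ : forall e, 0 < e -> J1 e = J2 e).
{ intros e He; rewrite <- (is_RInt_gen_unique (V := C_R_CompleteNormedModule) _ _ (HJ1 e He)).
  apply (is_RInt_gen_unique (V := C_R_CompleteNormedModule)).
  apply (is_RInt_gen_ext (V := C_R_NormedModule) I2); [|now apply HJ2].
  exists (fun x => x = e) (fun x => e < x); [reflexivity | now exists e |].
  intros x y -> Hy z [Hz _]; simpl in Hz; symmetry; apply EI.
  rewrite Rmin_left in Hz by lra; lra. }
apply (is_finite_part_unique J1); [exact HA|].
destruct HB as (n & lam & c & d & Hl & HB); exists n, lam, c, d; split; [exact Hl|].
revert HB; apply filterlim_ext_loc.
exists (mkposreal 1 Rlt_0_1); intros e _ He; now rewrite EJ.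
Qed.

(* Main.v *)
Require Import Defs.
From Stdlib Require Import Reals Lra Lia Arith.
From Coquelicot Require Import Coquelicot.
Open Scope R_scope.

(** Expanding the polynomial turns the integrand into a finite combination of
    products y^(l+q) e^(-a y) * z^(v s-p-q) e^(-b z), and both integrations are
    instances of one formula: the integral of x^(mu-1) e^(-c x) over the positive
    half-line is Gamma(mu) / c^mu.  The Gamma factors so produced cancel the ones
    in the denominators of the polynomial.  What is left is a double sum, in which
    the sum over s is a binomial expansion: the sum of (-(k-l))_s X^s / s! is
    (1 - X)^(k-l) with X = (w2/b)^v ([neg_binom_sum]), and the sum over l is then
    the terminating series 2F0 ([laplace_value_expansion]).

    The integral formula needs an argument in two respects.

    For mu > 0 the parameter c is complex, while Gamma is defined by the integral
    for c = 1.  Write c = r e^(i theta).  The integrand on the ray of angle theta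
    differs from the one on the real axis by the integral over the angle of a
    density that is also an exact x-derivative; hence the two primitives differ by
    a boundary term that vanishes at 0 and at infinity ([ray_primitive]).  This is
    Cauchy's theorem for a sector, with real differentiation under the integral
    sign in place of contour integrals.

    For mu < 0 not an integer the z-integral is a finite part.  Integration by
    parts expresses the tail of the integral for mu through the one for mu + 1 and
    a boundary term x^mu e^(-c x), whose finite part is zero because its Taylor
    expansion has only nonzero exponents ([is_finite_part_power_exp]).  So finite
    parts obey the recursion that defines Gamma to the left of 0, and induction
    starts from the convergent case ([laplace_power_finite_part_aux]).

    Both kinds of integral are handled through their tails: a function J with
    J' = -g that vanishes at infinity, together with its limit, or its finite
    part, at 0.  Both notions of value at 0 are linear, so the double sum is
    integrated term by term ([regularized_sum]).

    Finally, the values of p for which some exponent is a pole of Gamma are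
    isolated, so the formula holds on a punctured neighbourhood of every p; its
    right-hand side is continuous in p, which gives the limit statement. *)

(** * Complex-valued functions of a real variable *)

Notation is_derive_C := (is_derive (K := R_AbsRing) (V := C_R_NormedModule)).

Lemma filterlim_C {T : Type} (F : (T -> Prop) -> Prop) {FF : Filter F}
  (f : T -> C) (l : C) :
  filterlim f F (locally l) <->
  filterlim (fun t => Re (f t)) F (locally (Re l)) /\
  filterlim (fun t => Im (f t)) F (locally (Im l)).
Proof.
split.
- intros H; split.
  + apply (filterlim_comp _ _ _ f Re F (locally l)); [exact H|].
    intros P [eps HP]; exists eps; intros [y1 y2] [Hy _]; now apply HP.
  + apply (filterlim_comp _ _ _ f Im F (locally l)); [exact H|].
    intros P [eps HP]; exists eps; intros [y1 y2] [_ Hy]; now apply HP.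
- intros [H1 H2]; apply filterlim_locally; intros eps.
  apply filterlim_locally with (eps := eps) in H1.
  apply filterlim_locally with (eps := eps) in H2.
  generalize (filter_and _ _ H1 H2); apply filter_imp.
  intros t [E1 E2]; now split.
Qed.

Lemma filterlim_R_eq {T : Type} (F : (T -> Prop) -> Prop) (f : T -> R) (l l' : R) :
  filterlim f F (locally l) -> l = l' -> filterlim f F (locally l').
Proof. now intros H <-. Qed.

Lemma filterlim_C_eq {T : Type} (F : (T -> Prop) -> Prop) (f : T -> C) (l l' : C) :
  filterlim f F (locally l) -> l = l' -> filterlim f F (locally l').
Proof. now intros H <-. Qed.

Lemma filterlim_Rplus {T : Type} (F : (T -> Prop) -> Prop) {FF : Filter F}
  (f g : T -> R) (l m : R) :
  filterlim f F (locally l) -> filterlim g F (locally m) ->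
  filterlim (fun t => f t + g t) F (locally (l + m)).
Proof.
intros Hf Hg.
exact (filterlim_comp_2 _ _ _ Hf Hg
  (filterlim_plus (K := R_AbsRing) (V := R_NormedModule) l m)).
Qed.

Lemma filterlim_Rmult {T : Type} (F : (T -> Prop) -> Prop) {FF : Filter F}
  (f g : T -> R) (l m : R) :
  filterlim f F (locally l) -> filterlim g F (locally m) ->
  filterlim (fun t => f t * g t) F (locally (l * m)).
Proof.
intros Hf Hg.
exact (filterlim_comp_2 _ _ _ Hf Hg (filterlim_mult (K := R_AbsRing) l m)).
Qed.

Lemma filterlim_Ropp {T : Type} (F : (T -> Prop) -> Prop) {FF : Filter F}
  (f : T -> R) (l : R) :
  filterlim f F (locally l) -> filterlim (fun t => - f t) F (locally (- l)).
Proof.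
intros Hf; exact (filterlim_comp _ _ _ _ _ _ _ _ Hf
  (filterlim_opp (K := R_AbsRing) (V := R_NormedModule) l)).
Qed.

Lemma filterlim_Cplus {T : Type} (F : (T -> Prop) -> Prop) {FF : Filter F}
  (f g : T -> C) (l m : C) :
  filterlim f F (locally l) -> filterlim g F (locally m) ->
  filterlim (fun t => f t + g t)%C F (locally (l + m)%C).
Proof.
intros Hf Hg; apply (filterlim_C F) in Hf as [H1 H2], Hg as [H3 H4].
apply (filterlim_C F).
split; now apply (filterlim_Rplus F).
Qed.

Lemma filterlim_Cmult {T : Type} (F : (T -> Prop) -> Prop) {FF : Filter F}
  (f g : T -> C) (l m : C) :
  filterlim f F (locally l) -> filterlim g F (locally m) ->
  filterlim (fun t => f t * g t)%C F (locally (l * m)%C).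
Proof.
intros Hf Hg; apply (filterlim_C F) in Hf as [H1 H2], Hg as [H3 H4].
apply (filterlim_C F).
split; apply (filterlim_Rplus F); try apply (filterlim_Ropp F); now apply (filterlim_Rmult F).
Qed.

Lemma filterlim_R_eqC {T : Type} (F : (T -> Prop) -> Prop) {FF : Filter F}
  (f : T -> R) (l : R) :
  filterlim f F (locally l) ->
  filterlim (fun t => RtoC (f t)) F (locally (RtoC l)).
Proof.
intros H; apply (filterlim_C F); split; [exact H | apply filterlim_const].
Qed.

Lemma filterlim_Rsqueeze {T : Type} (F : (T -> Prop) -> Prop) {FF : Filter F}
  (f g : T -> R) :
  F (fun t => Rabs (f t) <= g t) -> filterlim g F (locally 0) ->
  filterlim f F (locally 0).
Proof.
intros Hle Hg; apply filterlim_locally; intros eps.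
apply filterlim_locally with (eps := eps) in Hg.
generalize (filter_and _ _ Hle Hg); apply filter_imp; intros t [H1 H2].
change (Rabs (g t - 0) < eps) in H2; change (Rabs (f t - 0) < eps).
rewrite Rminus_0_r in *; pose proof (Rle_abs (g t)); lra.
Qed.

Lemma filterlim_Csqueeze {T : Type} (F : (T -> Prop) -> Prop) {FF : Filter F}
  (f : T -> C) (g : T -> R) :
  F (fun t => Cmod (f t) <= g t) -> filterlim g F (locally 0) ->
  filterlim f F (locally (RtoC 0)).
Proof.
intros Hle Hg; apply (filterlim_C F); split;
  apply (filterlim_Rsqueeze F) with g; trivial;
  revert Hle; apply filter_imp; intros t Ht;
  eapply Rle_trans; try exact Ht; eapply Rle_trans; try apply Rmax_Cmod.
- apply Rmax_l.
- apply Rmax_r.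
Qed.

Lemma is_derive_C_parts (f : R -> C) (x : R) (l : C) :
  is_derive_C f x l <->
  is_derive (fun t => Re (f t)) x (Re l) /\ is_derive (fun t => Im (f t)) x (Im l).
Proof.
split.
- intros H; split.
  + exact (filterdiff_comp f (@fst R R) _ _ H (filterdiff_linear
      (U := prod_NormedModule R_AbsRing R_NormedModule R_NormedModule) _
      (is_linear_fst (U := R_NormedModule) (V := R_NormedModule)))).
  + exact (filterdiff_comp f (@snd R R) _ _ H (filterdiff_linear
      (U := prod_NormedModule R_AbsRing R_NormedModule R_NormedModule) _
      (is_linear_snd (U := R_NormedModule) (V := R_NormedModule)))).
- intros [H1 H2].
  apply (filterdiff_ext (V := C_R_NormedModule) (fun t => (Re (f t), Im (f t))) f).
  { intros t; symmetry; apply surjective_pairing. }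
  rewrite (surjective_pairing l).
  apply (filterdiff_comp'_2 (W := C_R_NormedModule) (fun t => Re (f t)) (fun t => Im (f t))
    (fun u v => (u, v)) x _ _ (fun u v => (u, v)) H1 H2).
  apply (filterdiff_ext_lin) with (l1 := fun t : prod_NormedModule R_AbsRing R_NormedModule R_NormedModule => t).
  + eapply filterdiff_ext; [|apply filterdiff_id].
    intros [u v]; reflexivity.
  + intros [u v]; reflexivity.
Qed.

Lemma is_derive_C_eq (f : R -> C) (x : R) (l l' : C) :
  is_derive_C f x l -> l = l' -> is_derive_C f x l'.
Proof. now intros H <-. Qed.

Lemma is_derive_C_ext (f g : R -> C) (x : R) (l : C) :
  (forall t, f t = g t) -> is_derive_C f x l -> is_derive_C g x l.
Proof. intros E; now apply (is_derive_ext (V := C_R_NormedModule)). Qed.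

Lemma is_derive_C_plus (f g : R -> C) (x : R) (l m : C) :
  is_derive_C f x l -> is_derive_C g x m ->
  is_derive_C (fun t => f t + g t)%C x (l + m)%C.
Proof. apply (is_derive_plus (V := C_R_NormedModule)). Qed.

Lemma is_derive_C_mult (f g : R -> C) (x : R) (l m : C) :
  is_derive_C f x l -> is_derive_C g x m ->
  is_derive_C (fun t => f t * g t)%C x (l * g x + f x * m)%C.
Proof.
intros H1 H2; apply is_derive_C_parts in H1 as [H1 H1'], H2 as [H2 H2'].
pose proof (fun u v l m Hu Hv => is_derive_mult (K := R_AbsRing) u v x l m Hu Hv Rmult_comm) as M.
apply is_derive_C_parts; split.
- pose proof (is_derive_minus _ _ _ _ _ (M _ _ _ _ H1 H2) (M _ _ _ _ H1' H2')) as H.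
  replace (Re (l * g x + f x * m)%C) with
    (minus (plus (mult (Re l) (Re (g x))) (mult (Re (f x)) (Re m)))
           (plus (mult (Im l) (Im (g x))) (mult (Im (f x)) (Im m)))); [exact H|].
  unfold minus, plus, opp, mult, Re, Im; simpl; ring.
- pose proof (is_derive_plus _ _ _ _ _ (M _ _ _ _ H1 H2') (M _ _ _ _ H1' H2)) as H.
  replace (Im (l * g x + f x * m)%C) with
    (plus (plus (mult (Re l) (Im (g x))) (mult (Re (f x)) (Im m)))
           (plus (mult (Im l) (Re (g x))) (mult (Im (f x)) (Re m)))); [exact H|].
  unfold minus, plus, opp, mult, Re, Im; simpl; ring.
Qed.

Lemma is_derive_RtoC (f : R -> R) (x l : R) :
  is_derive f x l -> is_derive_C (fun t => RtoC (f t)) x (RtoC l).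
Proof.
intros H; apply is_derive_C_parts; split; [exact H | exact (is_derive_const (V := R_NormedModule) 0 x)].
Qed.

Lemma is_derive_C_const (c : C) (x : R) : is_derive_C (fun _ => c) x (RtoC 0).
Proof. exact (is_derive_const (V := C_R_NormedModule) c x). Qed.

Lemma Cexp_plus (u v : C) : Cexp (u + v) = (Cexp u * Cexp v)%C.
Proof.
unfold Cexp; destruct u as [u1 u2], v as [v1 v2]; simpl.
rewrite exp_plus, cos_plus, sin_plus; unfold Cmult, RtoC; simpl; f_equal; ring.
Qed.

Lemma Cmod_Cexp (u : C) : Cmod (Cexp u) = exp (Re u).
Proof.
unfold Cexp; rewrite Cmod_mult, Cmod_R, Rabs_pos_eq by (left; apply exp_pos).
unfold Cmod; simpl.
replace (cos (Im u) * (cos (Im u) * 1) + sin (Im u) * (sin (Im u) * 1)) with 1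
  by (pose proof (sin2_cos2 (Im u)) as H; unfold Rsqr in H; lra).
rewrite sqrt_1; ring.
Qed.

Lemma is_derive_Cexp (c : C) (x : R) :
  is_derive_C (fun t => Cexp (- (c * RtoC t))) x (- c * Cexp (- (c * RtoC x)))%C.
Proof.
destruct c as [c1 c2]; apply is_derive_C_parts; split; unfold Cexp; simpl;
  auto_derive; trivial; unfold Rminus; ring.
Qed.

Lemma RtoC_neq_0 (r : R) : r <> 0 -> RtoC r <> RtoC 0.
Proof. intros H E; apply H; exact (f_equal Re E). Qed.

(** * Improper integrals from primitives *)

Lemma at_right_pos : at_right 0 (fun x => 0 < x).
Proof. exists (mkposreal 1 Rlt_0_1); now intros x _ Hx. Qed.

Lemma p_infty_gt (m : R) : Rbar_locally p_infty (fun x => m < x).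
Proof. now exists m. Qed.

(** The fundamental theorem at arbitrary ends of the half-line; applied with
    [Fa] the right neighbourhoods of 0 as well as with [Fa] a point. *)
Lemma is_RInt_gen_primitive (V : CompleteNormedModule R_AbsRing) (Fa Fb : (R -> Prop) -> Prop)
  {FFa : Filter Fa} {FFb : Filter Fb} (f Phi : R -> V) (la lb : V) :
  Fa (fun x => 0 < x) -> Fb (fun x => 0 < x) ->
  (forall x, 0 < x -> is_derive Phi x (f x)) ->
  (forall x, 0 < x -> continuous f x) ->
  filterlim Phi Fa (locally la) -> filterlim Phi Fb (locally lb) ->
  is_RInt_gen f Fa Fb (minus lb la).
Proof.
intros Ha Hb HD HC Hla Hlb.
apply (filterlimi_lim_ext_loc (F := filter_prod Fa Fb)
  (fun ab => minus (Phi (snd ab)) (Phi (fst ab)))).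
- exists (fun x => 0 < x) (fun x => 0 < x); trivial; intros x y Hx Hy; simpl.
  assert (Hm : 0 < Rmin x y) by now apply Rmin_glb_lt.
  apply is_RInt_derive; intros z [Hz _]; [apply HD | apply HC]; lra.
- unfold minus; apply (filterlim_comp_2 (G := locally lb) (H := locally (opp la))).
  + apply (filterlim_comp _ _ _ snd Phi _ Fb); [apply filterlim_snd | exact Hlb].
  + apply (filterlim_comp _ _ _ (fun ab => Phi (fst ab)) opp _ (locally la)).
    * apply (filterlim_comp _ _ _ fst Phi _ Fa); [apply filterlim_fst | exact Hla].
    * apply (filterlim_opp (K := R_AbsRing) (V := V)).
  + apply (filterlim_plus (K := R_AbsRing) (V := V)).
Qed.

(** Where [f] is dominated by the derivative of [G], the increments of a
    primitive of [f] are at most those of [G]: its Cauchy criterion is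
    inherited. *)
Lemma dominated_primitive_lim (F : (R -> Prop) -> Prop) {FF : ProperFilter F}
  (m : R) (Phi f G g : R -> R) (lG : R) :
  F (fun x => m < x) ->
  (forall x, m < x -> is_derive Phi x (f x)) ->
  (forall x, m < x -> is_derive G x (g x)) ->
  (forall x, m < x -> Rabs (f x) <= g x) ->
  filterlim G F (locally lG) ->
  exists l, filterlim Phi F (locally l).
Proof.
intros Hm HPhi HG Hle Hlim.
assert (mono : forall h h' : R -> R, (forall x, m < x -> is_derive h x (h' x)) ->
  (forall x, m < x -> 0 <= h' x) -> forall u v, m < u -> u <= v -> h u <= h v).
{ intros h h' Hh Hp u v Hu Huv.
  destruct (MVT_gen h u v h') as (c & Hc & E).
  - intros x Hx; apply Hh; rewrite Rmin_left in Hx by lra; lra.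
  - intros x Hx; apply continuity_pt_filterlim.
    apply (ex_derive_continuous (V := R_NormedModule)).
    exists (h' x); apply Hh; rewrite Rmin_left in Hx by lra; lra.
  - rewrite Rmin_left in Hc by lra.
    assert (H0 := Hp c ltac:(lra)).
    assert (0 <= h' c * (v - u)) by (apply Rmult_le_pos; lra); lra. }
assert (incr : forall u v, m < u -> u <= v -> Rabs (Phi v - Phi u) <= G v - G u).
{ intros u v Hu Huv.
  assert (H1 := mono (fun x => G x - Phi x) (fun x => g x - f x)
    ltac:(intros x Hx; exact (is_derive_minus (V := R_NormedModule) _ _ _ _ _ (HG x Hx) (HPhi x Hx)))
    ltac:(intros x Hx; generalize (Hle x Hx) (Rle_abs (f x)); lra) u v Hu Huv).
  assert (H2 := mono (fun x => G x + Phi x) (fun x => g x + f x)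
    ltac:(intros x Hx; exact (is_derive_plus (V := R_NormedModule) _ _ _ _ _ (HG x Hx) (HPhi x Hx)))
    ltac:(intros x Hx; generalize (Hle x Hx) (Rle_abs (- f x)); rewrite Rabs_Ropp; lra) u v Hu Huv).
  simpl in *; apply Rabs_le; lra. }
apply (filterlim_locally_cauchy (U := R_CompleteSpace) (F := F) Phi); intros eps.
destruct (proj2 (filterlim_locally_cauchy (U := R_CompleteSpace) (F := F) G) (ex_intro _ lG Hlim) eps) as (P & HP & HPG).
exists (fun x => m < x /\ P x); split; [now apply filter_and|].
intros u v [Hu Pu] [Hv Pv].
generalize (HPG u v Pu Pv) (HPG v u Pv Pu).
change (Rabs (G v - G u) < eps -> Rabs (G u - G v) < eps -> Rabs (Phi v - Phi u) < eps).
intros E1 E2; destruct (Rle_lt_dec u v) as [L|L].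
- generalize (incr u v Hu L) (Rle_abs (G v - G u)); lra.
- rewrite Rabs_minus_sym.
  generalize (incr v u Hv (Rlt_le _ _ L)) (Rle_abs (G u - G v)); lra.
Qed.

(** * Powers and exponentials at the ends of the half-line *)

Lemma is_derive_Rpower (s x : R) : 0 < x ->
  is_derive (fun x => Rpower x s) x (s * Rpower x (s - 1)).
Proof.
intros Hx; unfold Rpower; auto_derive; [exact Hx|].
replace ((s - 1) * ln x) with (s * ln x - ln x) by ring.
unfold Rminus; rewrite exp_plus, exp_Ropp, exp_ln by exact Hx; field; lra.
Qed.

Lemma Rpower_at_0 (s : R) : 0 < s ->
  filterlim (fun x => Rpower x s) (at_right 0) (locally 0).
Proof.
intros Hs; apply filterlim_locally; intros eps.
exists (mkposreal (Rpower eps (/ s)) (exp_pos _)); intros x Hx Hx0.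
change (Rabs (x - 0) < Rpower eps (/ s)) in Hx; change (Rabs (Rpower x s - 0) < eps).
rewrite Rminus_0_r in *; rewrite Rabs_pos_eq in * by (try left; try apply exp_pos; lra).
replace (pos eps) with (Rpower (Rpower eps (/ s)) s).
- apply Rlt_Rpower_l; [exact Hs | lra].
- rewrite Rpower_mult, Rinv_l, Rpower_1 by (try apply cond_pos; lra); reflexivity.
Qed.

Lemma exp_at_infty (beta : R) : 0 < beta ->
  filterlim (fun x => exp (- (beta * x))) (Rbar_locally p_infty) (locally 0).
Proof.
intros Hb.
apply (filterlim_comp _ _ _ (fun x => - (beta * x)) exp _ (Rbar_locally m_infty)).
- intros P [M HM]; exists (- M / beta); intros x Hx; apply HM.
  apply (Rmult_lt_compat_l beta) in Hx; [|exact Hb].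
  replace (beta * (- M / beta)) with (- M) in Hx by (field; lra); lra.
- exact is_lim_exp_m.
Qed.

Lemma Rpower_exp_at_infty (mu beta : R) : 0 < beta ->
  filterlim (fun x => Rpower x mu * exp (- (beta * x))) (Rbar_locally p_infty) (locally 0).
Proof.
intros Hb.
apply (filterlim_Rsqueeze _ _ (fun x => exp (- (beta / 2 * x))));
  [|apply exp_at_infty; lra].
(* Once ln x / x is below this bound, the power costs at most half of the
   exponential rate; the 1 avoids a division by zero when mu = 0. *)
assert (Hd : 0 < beta / (2 * (Rabs mu + 1))).
{ pose proof (Rabs_pos mu); apply Rdiv_lt_0_compat; lra. }
pose proof (proj1 (filterlim_locally (F := Rbar_locally p_infty) (fun y => ln y / y) 0) is_lim_div_ln_p (mkposreal _ Hd)) as H.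
generalize (filter_and _ _ H (p_infty_gt 0)); apply filter_imp.
intros x [Hx Hx0]; change (Rabs (ln x / x - 0) < beta / (2 * (Rabs mu + 1))) in Hx.
rewrite Rminus_0_r in Hx.
rewrite Rabs_pos_eq by (left; apply Rmult_lt_0_compat; apply exp_pos).
unfold Rpower; rewrite <- exp_plus.
assert (E : mu * ln x <= beta / 2 * x).
{ apply Rle_trans with (Rabs mu * (Rabs (ln x / x) * x)).
  - eapply Rle_trans; [apply Rle_abs|]; rewrite Rabs_mult.
    apply Rmult_le_compat_l; [apply Rabs_pos|].
    unfold Rdiv; rewrite Rabs_mult, (Rabs_pos_eq (/ x)) by (left; now apply Rinv_0_lt_compat).
    right; field; lra.
  - pose proof (Rabs_pos mu).
    apply Rle_trans with ((Rabs mu + 1) * (beta / (2 * (Rabs mu + 1)) * x)).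
    + apply Rmult_le_compat; try lra.
      * apply Rmult_le_pos; [apply Rabs_pos | lra].
      * apply Rmult_le_compat_r; lra.
    + right; field; lra. }
destruct (Rle_lt_or_eq_dec (mu * ln x + - (beta * x)) (- (beta / 2 * x)) ltac:(lra)) as [L|L].
- left; now apply exp_increasing.
- rewrite L; apply Rle_refl.
Qed.

(** * Euler's integral along rays of the right half-plane *)

Lemma is_derive_continuous (f : R -> R) (x l : R) : is_derive f x l -> continuous f x.
Proof. intros H; apply (ex_derive_continuous (V := R_NormedModule)); now exists l. Qed.

Lemma continuous_Rpower (s x : R) : 0 < x -> continuous (fun x => Rpower x s) x.
Proof. intros Hx; exact (is_derive_continuous _ _ _ (is_derive_Rpower s x Hx)). Qed.

Lemma Rpower_pred (s x : R) : 0 < x -> Rpower x s = x * Rpower x (s - 1).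
Proof.
intros Hx; replace (Rpower x s) with (Rpower x (1 + (s - 1))) by (f_equal; ring).
now rewrite Rpower_plus, Rpower_1.
Qed.

(** Euler's integral is dominated by x^(s-1) near 0 and by e^(-x/2) near
    infinity, both of which have explicit primitives.  The primitive is
    normalised to vanish at 0, so that its limit at infinity is the integral. *)
Lemma Gamma_pos_primitive (s : R) : 0 < s ->
  0 < Gamma_pos s /\
  exists Phi : R -> R,
    (forall x, 0 < x -> is_derive Phi x (Rpower x (s - 1) * exp (- x))) /\
    filterlim Phi (at_right 0) (locally 0) /\
    filterlim Phi (Rbar_locally p_infty) (locally (Gamma_pos s)).
Proof.
intros Hs.
set (f := fun x => Rpower x (s - 1) * exp (- x)).
assert (fpos : forall x, 0 < f x) by (intros x; apply Rmult_lt_0_compat; apply exp_pos).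
assert (fcont : forall x, 0 < x -> continuous f x).
{ intros x Hx; apply (continuous_mult (K := R_AbsRing)); [now apply continuous_Rpower|].
  apply (is_derive_continuous _ _ (- exp (- x))); auto_derive; trivial; ring. }
set (Phi1 := fun x => RInt f 1 x).
assert (D1 : forall x, 0 < x -> is_derive Phi1 x (f x)).
{ intros x Hx; apply (is_derive_RInt f Phi1 1); [|now apply fcont].
  exists (mkposreal x Hx); intros y Hy; apply (RInt_correct (V := R_CompleteNormedModule)).
  change (Rabs (y - x) < x) in Hy; apply Rabs_def2 in Hy.
  apply (ex_RInt_continuous (V := R_CompleteNormedModule)); intros z [Hz _]; apply fcont.
  assert (0 < Rmin 1 y) by (apply Rmin_glb_lt; lra); lra. }
destruct (dominated_primitive_lim (at_right 0) 0 Phi1 f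
  (fun x => / s * Rpower x s) (fun x => Rpower x (s - 1)) 0) as [l0 Hl0].
{ exact at_right_pos. }
{ exact D1. }
{ intros x Hx; replace (Rpower x (s - 1)) with (/ s * (s * Rpower x (s - 1))) by (field; lra).
  apply (is_derive_scal (fun x => Rpower x s)); now apply is_derive_Rpower. }
{ intros x Hx; rewrite Rabs_pos_eq by (left; apply fpos); unfold f.
  rewrite <- (Rmult_1_r (Rpower x (s - 1))) at 2.
  apply Rmult_le_compat_l; [left; apply exp_pos|].
  rewrite <- exp_0; left; apply exp_increasing; lra. }
{ eapply filterlim_R_eq; [apply (filterlim_Rmult _)|apply (Rmult_0_r (/ s))].
  - apply filterlim_const.
  - now apply Rpower_at_0. }
(* Eventually x^(s-1) <= e^(x/2): one half of the exponential is left. *)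
assert (Hev := proj1 (filterlim_locally (F := Rbar_locally p_infty) _ _)
  (Rpower_exp_at_infty (s - 1) (/ 2) ltac:(lra)) (mkposreal 1 Rlt_0_1)).
destruct Hev as [M HM].
destruct (dominated_primitive_lim (Rbar_locally p_infty) (Rmax M 0) Phi1 f
  (fun x => - 2 * exp (- (/ 2 * x))) (fun x => exp (- (/ 2 * x))) 0) as [l1 Hl1].
{ apply p_infty_gt. }
{ intros x Hx; apply D1; eapply Rle_lt_trans; [apply (Rmax_r M)|exact Hx]. }
{ intros x _; auto_derive; trivial; lra. }
{ intros x Hx; rewrite Rabs_pos_eq by (left; apply fpos); unfold f.
  assert (Hx' : M < x) by (eapply Rle_lt_trans; [apply (Rmax_l M 0)|exact Hx]).
  apply HM in Hx'; simpl in Hx'.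
  change (Rabs (Rpower x (s - 1) * exp (- (/ 2 * x)) - 0) < 1) in Hx'.
  rewrite Rminus_0_r in Hx'; apply Rabs_def2 in Hx' as [Hx' _].
  replace (- x) with (- (/ 2 * x) + - (/ 2 * x)) by lra; rewrite exp_plus, <- Rmult_assoc.
  rewrite <- Rmult_1_l; apply Rmult_le_compat_r; [left; apply exp_pos | lra]. }
{ eapply filterlim_R_eq; [apply (filterlim_Rmult _)|apply (Rmult_0_r (- 2))].
  - apply filterlim_const.
  - apply exp_at_infty; lra. }
assert (HG : Gamma_pos s = l1 - l0).
{ exact (is_RInt_gen_unique (V := R_CompleteNormedModule) f _
    (is_RInt_gen_primitive R_CompleteNormedModule (at_right 0) (Rbar_locally p_infty)
       f Phi1 l0 l1 at_right_pos (p_infty_gt 0) D1 fcont Hl0 Hl1)). }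
assert (L0 : filterlim (fun x => Phi1 x + - l0) (at_right 0) (locally 0)).
{ eapply filterlim_R_eq; [apply (filterlim_Rplus _)|apply (Rplus_opp_r l0)];
    [exact Hl0 | apply filterlim_const]. }
assert (L1 : filterlim (fun x => Phi1 x + - l0) (Rbar_locally p_infty) (locally (Gamma_pos s))).
{ rewrite HG; apply (filterlim_Rplus _); [exact Hl1 | apply filterlim_const]. }
split.
- assert (mono : forall u v, 0 < u -> u < v -> Phi1 u < Phi1 v).
  { intros u v Hu Huv; destruct (MVT_gen Phi1 u v f) as (c & Hc & E).
    - intros x Hx; apply D1; rewrite Rmin_left in Hx by lra; lra.
    - intros x Hx; apply continuity_pt_filterlim, (is_derive_continuous _ _ (f x)), D1.
      rewrite Rmin_left in Hx by lra; lra.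
    - assert (0 < f c * (v - u)) by (apply Rmult_lt_0_compat; [apply fpos | lra]); lra. }
  assert (l0 <= Phi1 1).
  { apply (filterlim_le (F := at_right 0) Phi1 (fun _ => Phi1 1) l0 (Phi1 1));
      [|exact Hl0|apply filterlim_const].
    exists (mkposreal 1 Rlt_0_1); intros x Hx Hx0; left; apply mono; [exact Hx0|].
    change (Rabs (x - 0) < 1) in Hx; apply Rabs_def2 in Hx; lra. }
  assert (Phi1 2 <= l1).
  { apply (filterlim_le (F := Rbar_locally p_infty) (fun _ => Phi1 2) Phi1 (Phi1 2) l1);
      [|apply filterlim_const|exact Hl1].
    exists 2; intros x Hx; left; apply mono; lra. }
  assert (Phi1 1 < Phi1 2) by (apply mono; lra); lra.
- exists (fun x => Phi1 x + - l0); split; [|now split].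
  intros x Hx; rewrite <- (Rplus_0_r (_ * _)).
  apply (is_derive_plus (V := R_NormedModule)); [now apply D1 | apply (is_derive_const (V := R_NormedModule))].
Qed.

(** The argument of e^(i (phi + s tau)) e^(-x e^(i tau)).  The free phase [phi]
    makes one real formula serve for real and imaginary parts. *)
Definition ray_phase (phi s tau x : R) : R := phi + s * tau - x * sin tau.

(** The real part of e^(i (phi + s tau)) x^(s-1) e^(-x e^(i tau)). *)
Definition ray_integrand (phi s tau x : R) : R :=
  Rpower x (s - 1) * exp (- (x * cos tau)) * cos (ray_phase phi s tau x).

(** With z = x e^(i tau): the real part of i e^(i phi) z^s e^(-z). *)
Definition ray_flux (phi s tau x : R) : R :=
  - (Rpower x s * exp (- (x * cos tau)) * sin (ray_phase phi s tau x)).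

(** The common value of the derivative of [ray_integrand] in [tau] and of
    [ray_flux] in [x]. *)
Definition ray_density (phi s tau x : R) : R :=
  Rpower x (s - 1) * exp (- (x * cos tau)) *
  (x * sin tau * cos (ray_phase phi s tau x)
   - (s - x * cos tau) * sin (ray_phase phi s tau x)).

Lemma is_derive_ray_integrand (phi s tau x : R) :
  is_derive (fun t => ray_integrand phi s t x) tau (ray_density phi s tau x).
Proof.
unfold ray_integrand, ray_density, ray_phase; auto_derive; trivial; unfold Rminus; ring.
Qed.

Lemma is_derive_ray_flux (phi s tau x : R) : 0 < x ->
  is_derive (ray_flux phi s tau) x (ray_density phi s tau x).
Proof.
intros Hx; unfold ray_flux, ray_density, ray_phase.
replace (Rpower x (s - 1)) with (Rpower x s / x).
- unfold Rpower; auto_derive; [exact Hx|]; unfold Rminus; field; lra.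
- rewrite (Rpower_pred s x Hx); field; lra.
Qed.

Lemma ray_flux_bound (phi s tau x : R) :
  Rabs (ray_flux phi s tau x) <= Rpower x s * exp (- (x * cos tau)).
Proof.
unfold ray_flux; rewrite Rabs_Ropp, Rabs_mult.
rewrite Rabs_pos_eq by (left; apply Rmult_lt_0_compat; apply exp_pos).
rewrite <- (Rmult_1_r (Rpower x s * exp (- (x * cos tau)))) at 2.
apply Rmult_le_compat_l; [left; apply Rmult_lt_0_compat; apply exp_pos|].
apply Rabs_le; generalize (SIN_bound (ray_phase phi s tau x)); lra.
Qed.

Lemma Rabs_RInt_le_const (f : R -> R) (a b M : R) :
  ex_RInt f a b -> (forall t, Rmin a b <= t <= Rmax a b -> Rabs (f t) <= M) ->
  Rabs (RInt f a b) <= Rabs (b - a) * M.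
Proof.
intros Hf HM; destruct (Rle_lt_dec a b) as [L|L].
- rewrite (Rabs_pos_eq (b - a)) by lra; apply abs_RInt_le_const; trivial.
  intros t Ht; apply HM; rewrite Rmin_left, Rmax_right; lra.
- rewrite <- (opp_RInt_swap (V := R_CompleteNormedModule)) by (now apply ex_RInt_swap).
  change (Rabs (- RInt f b a) <= Rabs (b - a) * M); rewrite Rabs_Ropp.
  rewrite Rabs_minus_sym, (Rabs_pos_eq (a - b)) by lra; apply abs_RInt_le_const; [lra|now apply ex_RInt_swap|].
  intros t Ht; apply HM; rewrite Rmin_right, Rmax_left; lra.
Qed.

Lemma continuity_2d_density (phi s x t : R) : 0 < x ->
  continuity_2d_pt (fun u v => ray_density phi s v u) x t.
Proof.
intros Hx; unfold ray_density, ray_phase.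
assert (cs : forall r, continuity_pt sin r) by apply continuity_sin.
assert (cc : forall r, continuity_pt cos r) by apply continuity_cos.
assert (C1 : continuity_2d_pt (fun u _ => u) x t) by apply continuity_2d_pt_id1.
assert (C2 : continuity_2d_pt (fun _ v => v) x t) by apply continuity_2d_pt_id2.
assert (S2 : continuity_2d_pt (fun _ v => sin v) x t)
  by (apply (continuity_1d_2d_pt_comp sin (fun _ v => v)); trivial).
assert (K2 : continuity_2d_pt (fun _ v => cos v) x t)
  by (apply (continuity_1d_2d_pt_comp cos (fun _ v => v)); trivial).
assert (A : continuity_2d_pt (fun u v => phi + s * v - u * sin v) x t).
{ apply continuity_2d_pt_minus; [apply continuity_2d_pt_plus|];
    try apply continuity_2d_pt_mult; trivial; apply continuity_2d_pt_const. }
apply continuity_2d_pt_mult; [apply continuity_2d_pt_mult|].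
- apply (continuity_1d_2d_pt_comp (fun r => Rpower r (s - 1)) (fun u _ => u)); trivial.
  apply continuity_pt_filterlim; now apply continuous_Rpower.
- apply (continuity_1d_2d_pt_comp exp (fun u v => - (u * cos v))).
  + apply derivable_continuous_pt, derivable_pt_exp.
  + apply continuity_2d_pt_opp; now apply continuity_2d_pt_mult.
- apply continuity_2d_pt_minus; apply continuity_2d_pt_mult.
  + now apply continuity_2d_pt_mult.
  + now apply (continuity_1d_2d_pt_comp cos (fun u v => phi + s * v - u * sin v)).
  + apply continuity_2d_pt_minus; [apply continuity_2d_pt_const|].
    now apply continuity_2d_pt_mult.
  + now apply (continuity_1d_2d_pt_comp sin (fun u v => phi + s * v - u * sin v)).
Qed.

(** Differentiating the flux in [x] under the integral sign gives the density,
    which integrates in the angle to the difference of the integrands. *)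
Lemma is_derive_RInt_flux (phi s theta x : R) : 0 < x ->
  is_derive (fun x => RInt (fun t => ray_flux phi s t x) 0 theta) x
    (ray_integrand phi s theta x - ray_integrand phi s 0 x).
Proof.
intros Hx.
assert (near : forall P : R -> Prop, (forall y, 0 < y -> P y) -> locally x P).
{ intros P HP; exists (mkposreal x Hx); intros y Hy; apply HP.
  change (Rabs (y - x) < x) in Hy; apply Rabs_def2 in Hy; lra. }
assert (E : RInt (fun t => Derive (fun u => ray_flux phi s t u) x) 0 theta
  = ray_integrand phi s theta x - ray_integrand phi s 0 x).
{ rewrite (RInt_ext _ (fun t => ray_density phi s t x)).
  2:{ intros t _; apply is_derive_unique; now apply is_derive_ray_flux. }
  apply (is_RInt_unique (V := R_CompleteNormedModule)).
  apply (is_RInt_derive (V := R_CompleteNormedModule) (fun t => ray_integrand phi s t x)).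
  - intros t _; apply is_derive_ray_integrand.
  - intros t _; unfold ray_density, ray_phase.
    apply (ex_derive_continuous (V := R_NormedModule)); now auto_derive. }
rewrite <- E; apply (is_derive_RInt_param (fun x t => ray_flux phi s t x)).
- apply near; intros y Hy t _; exists (ray_density phi s t y); now apply is_derive_ray_flux.
- intros t _; apply (continuity_2d_pt_ext_loc (fun u v => ray_density phi s v u)).
  + exists (mkposreal x Hx); intros u v Hu _; symmetry; apply is_derive_unique, is_derive_ray_flux.
    apply Rabs_def2 in Hu; simpl in Hu; lra.
  + now apply continuity_2d_density.
- apply near; intros y Hy; apply (ex_RInt_continuous (V := R_CompleteNormedModule)).
  intros t _; unfold ray_flux, ray_phase.
  apply (ex_derive_continuous (V := R_NormedModule)); now auto_derive.
Qed.

Lemma cos_ge_between (theta t : R) : - PI / 2 < theta < PI / 2 ->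
  Rmin 0 theta <= t <= Rmax 0 theta -> cos theta <= cos t.
Proof.
intros Ht; pose proof PI_RGT_0; unfold Rmin, Rmax; destruct (Rle_dec 0 theta); intros Hb.
- apply cos_decr_1; lra.
- rewrite <- (cos_neg theta), <- (cos_neg t); apply cos_decr_1; lra.
Qed.

(** The density that turns the ray integrand at angle [0] into the one at angle
    [theta] is an [x]-derivative, so the two integrals differ by boundary terms
    of [ray_flux], which vanish at both ends: Cauchy's theorem for the sector
    between the two rays. *)
Lemma ray_primitive (phi s theta : R) : 0 < s -> - PI / 2 < theta < PI / 2 ->
  exists Phi : R -> R,
    (forall x, 0 < x -> is_derive Phi x (ray_integrand phi s theta x)) /\
    filterlim Phi (at_right 0) (locally 0) /\
    filterlim Phi (Rbar_locally p_infty) (locally (cos phi * Gamma_pos s)).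
Proof.
intros Hs Ht; destruct (Gamma_pos_primitive s Hs) as (_ & Phi0 & D0 & L0 & L1).
set (Psi := fun x => RInt (fun t => ray_flux phi s t x) 0 theta).
assert (cpos : 0 < cos theta) by (apply cos_gt_0; lra).
assert (bound : forall x, 0 < x ->
  Rabs (Psi x) <= Rabs theta * (Rpower x s * exp (- (cos theta * x)))).
{ intros x Hx; rewrite <- (Rminus_0_r theta) at 1; apply Rabs_RInt_le_const.
  - apply (ex_RInt_continuous (V := R_CompleteNormedModule)); intros t _; unfold ray_flux, ray_phase.
    apply (ex_derive_continuous (V := R_NormedModule)); now auto_derive.
  - intros t Hb; eapply Rle_trans; [apply ray_flux_bound|].
    apply Rmult_le_compat_l; [left; apply exp_pos|].
    assert (Hc := cos_ge_between theta t Ht Hb).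
    assert (L : - (x * cos t) <= - (cos theta * x)) by nra.
    destruct L as [L|L]; [left; now apply exp_increasing | rewrite L; apply Rle_refl]. }
exists (fun x => cos phi * Phi0 x + Psi x); split; [|split].
- intros x Hx.
  replace (ray_integrand phi s theta x) with
    (cos phi * (Rpower x (s - 1) * exp (- x)) +
      (ray_integrand phi s theta x - ray_integrand phi s 0 x)).
  + apply (is_derive_plus (V := R_NormedModule)).
    * apply (is_derive_scal Phi0); now apply D0.
    * now apply is_derive_RInt_flux.
  + unfold ray_integrand at 2, ray_phase.
    rewrite cos_0, sin_0, !Rmult_0_r, Rplus_0_r, Rminus_0_r, Rmult_1_r; ring.
- eapply filterlim_R_eq; [apply (filterlim_Rplus _)|].
  + apply (filterlim_Rmult _); [apply filterlim_const|exact L0].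
  + apply (filterlim_Rsqueeze _ _ (fun x => Rabs theta * Rpower x s)).
    * generalize at_right_pos; apply filter_imp; intros x Hx.
      eapply Rle_trans; [now apply bound|]; apply Rmult_le_compat_l; [apply Rabs_pos|].
      rewrite <- (Rmult_1_r (Rpower x s)) at 2; apply Rmult_le_compat_l; [left; apply exp_pos|].
      rewrite <- exp_0; left; apply exp_increasing.
      assert (0 < cos theta * x) by (now apply Rmult_lt_0_compat); lra.
    * eapply filterlim_R_eq; [apply (filterlim_Rmult _)|apply (Rmult_0_r (Rabs theta))];
        [apply filterlim_const | now apply Rpower_at_0].
  + ring.
- eapply filterlim_R_eq; [apply (filterlim_Rplus _)|].
  + apply (filterlim_Rmult _); [apply filterlim_const|exact L1].
  + apply (filterlim_Rsqueeze _ _ (fun x => Rabs theta * (Rpower x s * exp (- (cos theta * x))))).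
    * generalize (p_infty_gt 0); apply filter_imp; exact bound.
    * eapply filterlim_R_eq; [apply (filterlim_Rmult _)|apply (Rmult_0_r (Rabs theta))];
        [apply filterlim_const | now apply Rpower_exp_at_infty].
  + ring.
Qed.

Lemma ray_primitive_scaled (phi s r theta : R) : 0 < s -> 0 < r -> - PI / 2 < theta < PI / 2 ->
  exists Phi : R -> R,
    (forall x, 0 < x -> is_derive Phi x
      (Rpower x (s - 1) * exp (- (r * cos theta * x)) * cos (phi - r * sin theta * x))) /\
    filterlim Phi (at_right 0) (locally 0) /\
    filterlim Phi (Rbar_locally p_infty)
      (locally (cos (phi - s * theta) * (Gamma_pos s * Rpower r (- s)))).
Proof.
intros Hs Hr Ht; destruct (ray_primitive (phi - s * theta) s theta Hs Ht) as (Phi & D & L0 & L1).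
exists (fun x => Phi (r * x) * Rpower r (- s)); split; [|split].
- intros x Hx.
  assert (Hrx : 0 < r * x) by (now apply Rmult_lt_0_compat).
  assert (H : is_derive (fun x => Phi (r * x)) x (r * ray_integrand (phi - s * theta) s theta (r * x))).
  { apply (is_derive_comp Phi (fun x => r * x)); [now apply D|]. auto_derive; trivial; ring. }
  apply (is_derive_scal_l (V := R_NormedModule)) with (k := Rpower r (- s)) in H.
  evar_last; [exact H|].
  unfold scal; simpl; unfold mult; simpl.
  unfold ray_integrand, ray_phase; rewrite <- Rpower_mult_distr by trivial.
  replace (phi - s * theta + s * theta - r * x * sin theta) with (phi - r * sin theta * x) by ring.
  replace (r * x * cos theta) with (r * cos theta * x) by ring.
  replace (r * (Rpower r (s - 1) * Rpower x (s - 1) * exp (- (r * cos theta * x)) *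
    cos (phi - r * sin theta * x)) * Rpower r (- s)) with
    ((r * Rpower r (s - 1)) * Rpower r (- s) * (Rpower x (s - 1) * exp (- (r * cos theta * x)) *
    cos (phi - r * sin theta * x))) by ring.
  rewrite <- Rpower_pred by trivial; rewrite <- Rpower_plus.
  replace (s + - s) with 0 by ring; rewrite Rpower_O by trivial; ring.
- eapply filterlim_R_eq; [apply (filterlim_Rmult _); [|apply filterlim_const]|apply Rmult_0_l].
  apply (filterlim_comp _ _ _ (fun x => r * x) Phi _ (at_right 0)); [|exact L0].
  intros P [d Hd]; assert (Hd' : 0 < d / r) by (apply Rdiv_lt_0_compat; [apply cond_pos|trivial]).
  exists (mkposreal _ Hd'); intros x Hx Hx0; apply Hd; [|now apply Rmult_lt_0_compat].
  change (Rabs (x - 0) < d / r) in Hx; change (Rabs (r * x - 0) < d).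
  rewrite Rminus_0_r in *; rewrite Rabs_mult, (Rabs_pos_eq r) by lra.
  apply (Rmult_lt_compat_l r) in Hx; trivial.
  now replace (r * (d / r)) with (pos d) in Hx by (field; lra).
- eapply filterlim_R_eq; [apply (filterlim_Rmult _); [|apply filterlim_const]|apply Rmult_assoc].
  apply (filterlim_comp _ _ _ (fun x => r * x) Phi _ (Rbar_locally p_infty)); [|exact L1].
  intros P [M HM]; exists (M / r); intros x Hx; apply HM.
  apply (Rmult_lt_compat_l r) in Hx; trivial.
  now replace (r * (M / r)) with M in Hx by (field; lra).
Qed.

Lemma polar_form (c : C) : 0 < Re c ->
  let theta := atan (Im c / Re c) in
  Re c = Cmod c * cos theta /\ Im c = Cmod c * sin theta.
Proof.
intros Hc; simpl; rewrite cos_atan, sin_atan.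
assert (E : Cmod c = Re c * sqrt (1 + Rsqr (Im c / Re c))).
{ rewrite <- (sqrt_square (Re c)) at 1 by lra; rewrite <- sqrt_mult_alt by nra.
  unfold Cmod; f_equal; unfold Rsqr, Re, Im in *; field; lra. }
assert (0 < sqrt (1 + Rsqr (Im c / Re c))) by (apply sqrt_lt_R0; pose proof (Rle_0_sqr (Im c / Re c)); lra).
rewrite E; split; field; lra.
Qed.

(** The exponent is shifted by one so that the integral over the half-line is
    Gamma(mu) / c^mu. *)
Definition laplace_kernel (mu : R) (c : C) (x : R) : C :=
  (RtoC (Rpower x (mu - 1)) * Cexp (- (c * RtoC x)))%C.

Lemma Cmod_gt_0_Re (c : C) : 0 < Re c -> 0 < Cmod c.
Proof. intros Hc; apply Cmod_gt_0; intros ->; simpl in Hc; lra. Qed.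

Lemma Cpower_opp (c : C) (x : R) : (Cpower c (- x) * Cpower c x)%C = RtoC 1.
Proof.
unfold Cpower; set (th := atan _).
replace (- x * th) with (- (x * th)) by ring; rewrite cos_neg, sin_neg, Rpower_Ropp.
assert (H : 0 < Rpower (Cmod c) x) by apply exp_pos.
pose proof (sin2_cos2 (x * th)) as E; unfold Rsqr in E.
unfold Cmult, RtoC; simpl; f_equal; field_simplify; lra.
Qed.

Lemma Cpower_neq_0 (c : C) (x : R) : Cpower c x <> RtoC 0.
Proof.
intros E; pose proof (Cpower_opp c x) as H; rewrite E, Cmult_0_r in H.
injection H; lra.
Qed.

Lemma Cpower_inv (c : C) (x : R) : (/ Cpower c x)%C = Cpower c (- x).
Proof.
rewrite <- (Cmult_1_l (/ _)), <- (Cpower_opp c x); field; apply Cpower_neq_0.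
Qed.

(** Real and imaginary parts are the phases 0 and -pi/2 of the ray formula. *)
Lemma laplace_kernel_primitive (s : R) (c : C) : 0 < s -> 0 < Re c ->
  exists Phi : R -> C,
    (forall x, 0 < x -> is_derive_C Phi x (laplace_kernel s c x)) /\
    filterlim Phi (at_right 0) (locally (RtoC 0)) /\
    filterlim Phi (Rbar_locally p_infty) (locally (RtoC (Gamma_pos s) / Cpower c s)%C).
Proof.
intros Hs Hc; destruct (polar_form c Hc) as [Er Ei]; set (theta := atan (Im c / Re c)) in *.
assert (Ht : - PI / 2 < theta < PI / 2).
{ pose proof (atan_bound (Im c / Re c)) as B; unfold theta; lra. }
pose proof (Cmod_gt_0_Re c Hc) as Hr.
destruct (ray_primitive_scaled 0 s (Cmod c) theta Hs Hr Ht) as (P1 & D1 & L1 & M1).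
destruct (ray_primitive_scaled (- (PI / 2)) s (Cmod c) theta Hs Hr Ht) as (P2 & D2 & L2 & M2).
rewrite <- Er, <- Ei in *.
exists (fun x => (P1 x, P2 x)); split; [|split].
- intros x Hx; apply is_derive_C_parts; split; evar_last; try (now apply D1); try (now apply D2);
    unfold laplace_kernel, Cexp; destruct c as [c1 c2]; simpl.
  + replace (- (c1 * 0 + c2 * x)) with (0 - c2 * x) by ring.
    replace (- (c1 * x - c2 * 0)) with (- (c1 * x)) by ring; ring.
  + replace (- (c1 * 0 + c2 * x)) with (- (c2 * x)) by ring.
    replace (- (c1 * x - c2 * 0)) with (- (c1 * x)) by ring.
    replace (- (PI / 2) - c2 * x) with (- (PI / 2 + c2 * x)) by ring.
    rewrite cos_neg, sin_neg, sin_cos; ring.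
- apply (filterlim_C _); split; assumption.
- unfold Cdiv; rewrite Cpower_inv; apply (filterlim_C _).
  unfold Cpower; fold theta; split; eapply filterlim_R_eq; try exact M1; try exact M2; simpl.
  + replace (0 - s * theta) with (- s * theta) by ring; ring.
  + replace (- (PI / 2) - s * theta) with (- (PI / 2 + s * theta)) by ring.
    replace (- s * theta) with (- (s * theta)) by ring.
    rewrite cos_neg, sin_neg, sin_cos; ring.
Qed.

(** * Regularised integrals through their tails *)

(** [J x] is the integral of [g] from [x] to infinity, described by what makes
    it so: this form is stable under linear combinations and integration by
    parts without any convergence argument. *)
Definition tail_of (g J : R -> C) : Prop :=
  (forall x, 0 < x -> continuous g x) /\
  (forall x, 0 < x -> is_derive_C J x (- g x)%C) /\
  filterlim J (Rbar_locally p_infty) (locally (RtoC 0)).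

Definition limit_at_0 (J : R -> C) (A : C) : Prop := filterlim J (at_right 0) (locally A).

Definition linear_limit (T : (R -> C) -> C -> Prop) : Prop :=
  (forall J K A B, T J A -> T K B -> T (fun e => J e + K e)%C (A + B)%C) /\
  (forall k J A, T J A -> T (fun e => k * J e)%C (k * A)%C).

(** The integral of [g] over the half-line, where [T] says in which sense the
    tail has a value at 0. *)
Definition regularized_integral (T : (R -> C) -> C -> Prop) (g : R -> C) (A : C) : Prop :=
  exists J, tail_of g J /\ T J A.

Lemma tail_of_plus (g h J K : R -> C) : tail_of g J -> tail_of h K ->
  tail_of (fun x => g x + h x)%C (fun x => J x + K x)%C.
Proof.
intros (C1 & D1 & L1) (C2 & D2 & L2); split; [|split].
- intros x Hx; apply (filterlim_Cplus _); [now apply C1 | now apply C2].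
- intros x Hx; eapply is_derive_C_eq; [apply is_derive_C_plus; [now apply D1 | now apply D2]|].
  ring.
- eapply filterlim_C_eq; [apply (filterlim_Cplus _); [exact L1|exact L2]|]; ring.
Qed.

Lemma tail_of_Cmult (k : C) (g J : R -> C) : tail_of g J ->
  tail_of (fun x => k * g x)%C (fun x => k * J x)%C.
Proof.
intros (C1 & D1 & L1); split; [|split].
- intros x Hx; apply (filterlim_Cmult _); [apply filterlim_const | now apply C1].
- intros x Hx; eapply is_derive_C_eq; [apply is_derive_C_mult; [apply is_derive_C_const | now apply D1]|].
  cbv beta; ring.
- eapply filterlim_C_eq; [apply (filterlim_Cmult _); [apply filterlim_const|exact L1]|]; ring.
Qed.

Lemma regularized_ext (T : (R -> C) -> C -> Prop) (g h : R -> C) (A : C) :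
  (forall x, 0 < x -> g x = h x) ->
  regularized_integral T g A -> regularized_integral T h A.
Proof.
intros E (J & (C1 & D1 & L1) & HT); exists J; split; [split; [|split]|]; trivial.
- intros x Hx; apply (continuous_ext_loc h g x); [|now apply C1].
  exists (mkposreal x Hx); intros y Hy; apply E.
  change (Rabs (y - x) < x) in Hy; apply Rabs_def2 in Hy; lra.
- intros x Hx; rewrite <- E by trivial; now apply D1.
Qed.

Lemma regularized_Cmult (T : (R -> C) -> C -> Prop) (HT : linear_limit T)
  (k : C) (g : R -> C) (A : C) :
  regularized_integral T g A -> regularized_integral T (fun x => k * g x)%C (k * A)%C.
Proof.
intros (J & H1 & H2); exists (fun x => k * J x)%C; split;
  [now apply tail_of_Cmult | now apply HT].
Qed.

Lemma regularized_sum (T : (R -> C) -> C -> Prop) (HT : linear_limit T)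
  (g : nat -> R -> C) (A : nat -> C) (n : nat) :
  (forall j, (j <= n)%nat -> regularized_integral T (g j) (A j)) ->
  regularized_integral T (fun x => sum_n (fun j => g j x) n) (sum_n A n).
Proof.
induction n as [|n IH]; intros H.
- rewrite sum_O; apply regularized_ext with (g 0%nat); [|now apply H].
  intros x _; now rewrite sum_O.
- rewrite sum_Sn.
  destruct (IH (fun j Hj => H j (Nat.le_trans _ _ _ Hj (Nat.le_succ_diag_r n)))) as (J & H1 & H2).
  destruct (H (S n) (le_n _)) as (K & H3 & H4).
  apply regularized_ext with (fun x => sum_n (fun j => g j x) n + g (S n) x)%C.
  { intros x _; now rewrite sum_Sn. }
  exists (fun x => J x + K x)%C; split; [now apply tail_of_plus | now apply HT].
Qed.

Lemma tail_of_is_RInt_gen (g J : R -> C) (Fa : (R -> Prop) -> Prop) {FFa : Filter Fa} (A : C) :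
  tail_of g J -> Fa (fun x => 0 < x) -> filterlim J Fa (locally A) ->
  is_RInt_gen (V := C_R_NormedModule) g Fa (Rbar_locally p_infty) A.
Proof.
intros (C1 & D1 & L1) Hp HA.
replace A with (minus (G := C_R_CompleteNormedModule) (- RtoC 0)%C (- A)%C)
  by (unfold minus, plus, opp; simpl; change (- RtoC 0 + - - A = A)%C; ring).
assert (opp_lim : forall (F : (R -> Prop) -> Prop) (l : C), Filter F ->
  filterlim J F (locally l) -> filterlim (fun x => - J x)%C F (locally (- l)%C)).
{ intros F l HF H; eapply filterlim_C_eq.
  - apply (filterlim_ext (fun x => (- RtoC 1) * J x)%C);
      [intros x; change (- RtoC 1 * J x = - J x)%C; ring|].
    apply (filterlim_Cmult _); [apply filterlim_const | exact H].
  - ring. }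
apply (is_RInt_gen_primitive C_R_CompleteNormedModule Fa (Rbar_locally p_infty) g (fun x => - J x)%C).
- exact Hp.
- apply p_infty_gt.
- intros x Hx; apply (is_derive_C_ext (fun x => (- RtoC 1) * J x)%C).
  + intros t; ring.
  + eapply is_derive_C_eq; [apply is_derive_C_mult; [apply is_derive_C_const | now apply D1]|].
    cbv beta; ring.
- exact C1.
- now apply opp_lim.
- now apply opp_lim; [apply Rbar_locally_filter|].
Qed.

Lemma is_laplace2_intro (f : R -> R -> C) (a b A : C) (I : R -> C) :
  (forall z, 0 < z -> regularized_integral limit_at_0
     (fun y => Cexp (- (a * RtoC y + b * RtoC z)) * f y z)%C (I z)) ->
  regularized_integral is_finite_part I A -> is_laplace2 f a b A.
Proof.
intros HI (J & HJ & HA); exists I, J; split; [|split; [|exact HA]].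
- intros z Hz; destruct (HI z Hz) as (K & HK & HK0).
  apply (tail_of_is_RInt_gen _ K (at_right 0)); [exact HK | exact at_right_pos | exact HK0].
- intros e He; apply (tail_of_is_RInt_gen _ J (at_point e)); [exact HJ | exact He |].
  intros P HP; exact (locally_singleton _ _ HP).
Qed.

Lemma linear_limit_at_0 : linear_limit limit_at_0.
Proof.
split.
- intros J K A B; apply (filterlim_Cplus _).
- intros k J A HJ; apply (filterlim_Cmult _); [apply filterlim_const | exact HJ].
Qed.

(** * Algebra of finite parts *)

Lemma sum_n_concat (u w : nat -> C) (n m : nat) :
  sum_n (fun j => if Nat.leb j n then u j else w (j - S n)%nat) (S n + m)
  = (sum_n u n + sum_n w m)%C :> C.
Proof.
induction m as [|m IH].
- rewrite Nat.add_0_r, sum_Sn, sum_O.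
  rewrite (sum_n_ext_loc _ u).
  2:{ intros j Hj; destruct (Nat.leb_spec j n); [reflexivity|lia]. }
  destruct (Nat.leb_spec (S n) n); [lia|]; now rewrite Nat.sub_diag.
- rewrite Nat.add_succ_r, !sum_Sn, IH.
  destruct (Nat.leb_spec (S (S n + m)) n); [lia|].
  replace (S (S n + m) - S n)%nat with (S m) by lia.
  change (sum_n u n + sum_n w m + w (S m) = sum_n u n + (sum_n w m + w (S m)))%C; ring.
Qed.

Lemma sum_n_Cmult (k : C) (u : nat -> C) (n : nat) :
  sum_n (fun j => k * u j)%C n = (k * sum_n u n)%C :> C.
Proof.
induction n as [|n IH]; [now rewrite !sum_O|].
rewrite !sum_Sn, IH.
change (k * sum_n u n + k * u (S n) = k * (sum_n u n + u (S n)))%C; ring.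
Qed.

Lemma linear_finite_part : linear_limit is_finite_part.
Proof.
split.
- intros J K A B (n & lam & c & d & Hl & HJ) (n' & lam' & c' & d' & Hl' & HK).
  exists (S n + n')%nat, (fun j => if Nat.leb j n then lam j else lam' (j - S n)%nat),
    (fun j => if Nat.leb j n then c j else c' (j - S n)%nat), (d + d')%C; split.
  + intros j Hj; destruct (Nat.leb_spec j n); [now apply Hl | apply Hl'; lia].
  + generalize (filterlim_Cplus _ _ _ _ _ HJ HK); apply filterlim_ext; intros e.
    rewrite (sum_n_ext (fun j => ((if Nat.leb j n then c j else c' (j - S n)%nat)
        * RtoC (Rpower e (- (if Nat.leb j n then lam j else lam' (j - S n)%nat))))%C)
      (fun j => if Nat.leb j n then (c j * RtoC (Rpower e (- lam j)))%C
      else (c' (j - S n)%nat * RtoC (Rpower e (- lam' (j - S n)%nat)))%C)).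
    2:{ intros j; now destruct (Nat.leb j n). }
    rewrite (sum_n_concat (fun j => (c j * RtoC (Rpower e (- lam j)))%C)
      (fun j => (c' j * RtoC (Rpower e (- lam' j)))%C)); ring.
- intros k J A (n & lam & c & d & Hl & HJ).
  exists n, lam, (fun j => k * c j)%C, (k * d)%C; split; [exact Hl|].
  generalize (filterlim_Cmult _ _ _ _ _ (filterlim_const k) HJ); apply filterlim_ext; intros e.
  rewrite (sum_n_ext (fun j => (k * c j * RtoC (Rpower e (- lam j)))%C)
    (fun j => (k * (c j * RtoC (Rpower e (- lam j))))%C)) by (intros j; symmetry; apply Cmult_assoc).
  rewrite sum_n_Cmult; ring.
Qed.

Lemma is_finite_part_lim (J : R -> C) (A : C) : limit_at_0 J A -> is_finite_part J A.
Proof.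
intros HJ; exists 0%nat, (fun _ => 1), (fun _ => RtoC 0), (RtoC 0); split; [intros; lra|].
revert HJ; apply filterlim_ext; intros e; rewrite sum_O; ring.
Qed.

Lemma is_finite_part_ext (J K : R -> C) (A : C) :
  (forall e, 0 < e -> J e = K e) -> is_finite_part J A -> is_finite_part K A.
Proof.
intros E (n & lam & c & d & Hl & HJ); exists n, lam, c, d; split; [exact Hl|].
revert HJ; apply filterlim_ext_loc.
generalize at_right_pos; apply filter_imp; intros e He; now rewrite E.
Qed.

(** A positive power tends to 0 and a negative one is itself a divergent scale. *)
Lemma is_finite_part_power (mu : R) : mu <> 0 ->
  is_finite_part (fun e => RtoC (Rpower e mu)) (RtoC 0).
Proof.
intros Hmu; destruct (Rle_lt_dec mu 0) as [L|L].
- exists 0%nat, (fun _ => - mu), (fun _ => RtoC 1), (RtoC 0); split; [intros; lra|].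
  apply (filterlim_ext (fun _ => RtoC 0)); [|apply filterlim_const].
  intros e; rewrite sum_O, Ropp_involutive; ring.
- apply is_finite_part_lim, (filterlim_R_eqC _); now apply Rpower_at_0.
Qed.

(** [exp_remainder c n] is e^(-c x) minus its Taylor polynomial of degree
    [n - 1], so that it is of order x^n; for [n = 0] nothing is subtracted. *)
Fixpoint exp_remainder (c : C) (n : nat) (x : R) : C :=
  match n with
  | O => Cexp (- (c * RtoC x))
  | S m => (exp_remainder c m x - (- c) ^ m / RtoC (INR (fact m)) * RtoC (x ^ m))%C
  end.

Lemma is_derive_exp_remainder (c : C) (n : nat) (x : R) :
  is_derive_C (exp_remainder c (S n)) x (- c * exp_remainder c n x)%C.
Proof.
induction n as [|n IH].
- simpl; eapply is_derive_C_eq.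
  + apply (is_derive_C_plus _ (fun _ => - (1 / RtoC 1 * RtoC 1))%C);
      [apply is_derive_Cexp | apply is_derive_C_const].
  + ring.
- change (exp_remainder c (S (S n))) with
    (fun x => exp_remainder c (S n) x - (- c) ^ (S n) / RtoC (INR (fact (S n))) * RtoC (x ^ S n))%C.
  eapply is_derive_C_eq.
  + apply is_derive_C_plus; [exact IH|].
    apply (is_derive_C_ext
      (fun x => - ((- c) ^ (S n) / RtoC (INR (fact (S n)))) * RtoC (x ^ S n))%C); [intros t; ring|].
    apply is_derive_C_mult; [apply is_derive_C_const|].
    apply is_derive_RtoC.
    instantiate (1 := INR (S n) * x ^ n); auto_derive; trivial.
    change (1 * (INR (S n) * x ^ n) = INR (S n) * x ^ n); ring.
  + change (exp_remainder c (S n) x) with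
      (exp_remainder c n x - (- c) ^ n / RtoC (INR (fact n)) * RtoC (x ^ n))%C.
    rewrite fact_simpl, mult_INR; cbv beta; rewrite Cpow_S.
    assert (RtoC (INR (S n)) <> RtoC 0) by (apply RtoC_neq_0, not_0_INR; lia).
    assert (RtoC (INR (fact n)) <> RtoC 0) by (apply RtoC_neq_0, INR_fact_neq_0).
    rewrite !RtoC_mult; field; auto.
Qed.

Lemma exp_remainder_0 (c : C) (n : nat) : exp_remainder c (S n) 0 = RtoC 0.
Proof.
induction n as [|n IH].
- simpl; unfold Cexp; destruct c as [c1 c2]; simpl.
  replace (- (c1 * 0 - c2 * 0)) with 0 by ring; replace (- (c1 * 0 + c2 * 0)) with 0 by ring.
  rewrite exp_0, cos_0, sin_0; apply injective_projections; simpl; field.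
- change (exp_remainder c (S n) 0 - (- c) ^ (S n) / RtoC (INR (fact (S n))) * RtoC (0 ^ S n) = RtoC 0)%C.
  rewrite IH, pow_i by lia; ring.
Qed.

(** The derivative of a remainder is [- c] times the previous one and all but
    the first vanish at 0, so the mean value theorem gains one power of [x] at each
    step; the factor 2 comes from treating the two parts separately. *)
Lemma exp_remainder_bound (c : C) (n : nat) : 0 < Re c ->
  exists M, 0 <= M /\ forall x, 0 <= x -> Cmod (exp_remainder c n x) <= M * x ^ n.
Proof.
intros Hc; induction n as [|n (M & HM & IH)].
- exists 1; split; [lra|]; intros x Hx; simpl; rewrite Cmod_Cexp, Rmult_1_r, <- exp_0.
  destruct c as [c1 c2]; simpl in *; assert (0 <= c1 * x) by (apply Rmult_le_pos; lra).
  destruct (Req_dec (- (c1 * x - c2 * 0)) 0) as [->|Hn]; [apply Rle_refl|].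
  left; apply exp_increasing; lra.
- exists (2 * (Cmod c * M)); split.
  { apply Rmult_le_pos; [lra|]; apply Rmult_le_pos; [apply Cmod_ge_0 | exact HM]. }
  intros x Hx.
  assert (B : forall y, 0 <= y <= x -> Cmod (- c * exp_remainder c n y) <= Cmod c * M * x ^ n).
  { intros y Hy; rewrite Cmod_mult, Cmod_opp, Rmult_assoc.
    apply Rmult_le_compat_l; [apply Cmod_ge_0|].
    eapply Rle_trans; [apply IH; lra|]; apply Rmult_le_compat_l; trivial; apply pow_incr; lra. }
  assert (part : forall pr : C -> R, (forall z, Rabs (pr z) <= Cmod z) -> pr (RtoC 0) = 0 ->
    (forall y, is_derive (fun t => pr (exp_remainder c (S n) t)) y (pr (- c * exp_remainder c n y)%C)) ->
    Rabs (pr (exp_remainder c (S n) x)) <= Cmod c * M * x ^ S n).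
  { intros pr Hpr pr0 D.
    destruct (MVT_gen (fun t => pr (exp_remainder c (S n) t)) 0 x
      (fun y => pr (- c * exp_remainder c n y)%C)) as (y & Hy & E).
    - intros y _; apply D.
    - intros y _; apply continuity_pt_filterlim; exact (is_derive_continuous _ _ _ (D y)).
    - rewrite Rmin_left, Rmax_right in Hy by lra.
      rewrite exp_remainder_0, pr0, !Rminus_0_r in E; rewrite E, Rabs_mult, (Rabs_pos_eq x) by lra.
      replace (Cmod c * M * x ^ S n) with (Cmod c * M * x ^ n * x) by (simpl; ring).
      apply Rmult_le_compat_r; [lra|]; eapply Rle_trans; [apply Hpr | now apply B]. }
  assert (H := fun y => proj1 (is_derive_C_parts _ _ _) (is_derive_exp_remainder c n y)).
  assert (H1 := part Re (fun z => Rle_trans _ _ _ (Rmax_l _ _) (Rmax_Cmod z)) eq_refl (fun y => proj1 (H y))).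
  assert (H2 := part Im (fun z => Rle_trans _ _ _ (Rmax_r _ _) (Rmax_Cmod z)) eq_refl (fun y => proj2 (H y))).
  replace (exp_remainder c (S n) x) with
    (RtoC (Re (exp_remainder c (S n) x)) + Ci * RtoC (Im (exp_remainder c (S n) x)))%C.
  + eapply Rle_trans; [apply Cmod_triangle|].
    rewrite Cmod_mult, !Cmod_R.
    replace (Cmod Ci) with 1; [lra|].
    unfold Cmod, Ci; simpl; rewrite Rmult_0_l, Rplus_0_l, !Rmult_1_l, sqrt_1; reflexivity.
  + destruct (exp_remainder c (S n) x) as [u1 u2]; apply injective_projections; simpl; ring.
Qed.

Definition not_pole (mu : R) : Prop := forall n : nat, mu <> - INR n.

Lemma not_pole_shift (mu : R) (n : nat) : not_pole mu -> not_pole (mu + INR n).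
Proof. intros H m E; apply (H (n + m)%nat); rewrite plus_INR; lra. Qed.

Lemma nat_above (x : R) : exists n : nat, x < INR n.
Proof.
destruct (archimed x) as [H _]; exists (Z.to_nat (up x)).
rewrite INR_IZR_INZ; eapply Rlt_le_trans; [exact H|]; apply IZR_le; lia.
Qed.

(** Every term of the Taylor polynomial of the exponential contributes a pure
    power of nonzero exponent, and far enough in the expansion the remainder
    vanishes in the limit. *)
Lemma is_finite_part_power_exp (mu : R) (c : C) : 0 < Re c -> not_pole mu ->
  is_finite_part (fun e => RtoC (Rpower e mu) * Cexp (- (c * RtoC e)))%C (RtoC 0).
Proof.
intros Hc Hmu; destruct linear_finite_part as [fp_plus fp_mult].
assert (poly : forall n, is_finite_part
  (fun e => RtoC (Rpower e mu) * (Cexp (- (c * RtoC e)) - exp_remainder c n e))%C (RtoC 0)).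
{ induction n as [|n IH].
  - apply is_finite_part_lim; unfold limit_at_0.
    apply (filterlim_ext (fun _ => RtoC 0)); [intros e; simpl; ring | apply filterlim_const].
  - assert (Hn : mu + INR n <> 0) by (intros E; apply (Hmu n); lra).
    assert (H := fp_plus _ _ _ _ IH (fp_mult ((- c) ^ n / RtoC (INR (fact n)))%C _ _
      (is_finite_part_power _ Hn))).
    replace (RtoC 0) with (RtoC 0 + (- c) ^ n / RtoC (INR (fact n)) * RtoC 0)%C by ring.
    revert H; apply is_finite_part_ext; intros e He; simpl exp_remainder.
    rewrite Rpower_plus, Rpower_pow, RtoC_mult by trivial; ring. }
destruct (nat_above (- mu)) as [n Hn].
destruct (exp_remainder_bound c n Hc) as (M & _ & HM).
assert (rem : is_finite_part (fun e => RtoC (Rpower e mu) * exp_remainder c n e)%C (RtoC 0)).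
{ apply is_finite_part_lim, (filterlim_Csqueeze _ _ (fun e => M * Rpower e (mu + INR n))).
  - generalize at_right_pos; apply filter_imp; intros e He.
    rewrite Cmod_mult, Cmod_R, Rabs_pos_eq by (left; apply exp_pos).
    rewrite Rpower_plus, Rpower_pow by trivial.
    replace (M * (Rpower e mu * e ^ n)) with (Rpower e mu * (M * e ^ n)) by ring.
    apply Rmult_le_compat_l; [left; apply exp_pos | apply HM; lra].
  - eapply filterlim_R_eq; [apply (filterlim_Rmult _)|apply (Rmult_0_r M)];
      [apply filterlim_const | apply Rpower_at_0; lra]. }
replace (RtoC 0) with (RtoC 0 + RtoC 0)%C by ring.
generalize (fp_plus _ _ _ _ (poly n) rem); apply is_finite_part_ext; intros e _; ring.
Qed.

(** * Laplace integrals of powers *)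

Lemma is_derive_laplace_kernel (mu : R) (c : C) (x : R) : 0 < x ->
  is_derive_C (laplace_kernel (mu + 1) c) x
    (RtoC mu * laplace_kernel mu c x - c * laplace_kernel (mu + 1) c x)%C.
Proof.
intros Hx; unfold laplace_kernel; eapply is_derive_C_eq.
- apply is_derive_C_mult; [|apply is_derive_Cexp].
  apply is_derive_RtoC; replace (mu + 1 - 1) with mu by ring; now apply is_derive_Rpower.
- rewrite RtoC_mult; ring.
Qed.

Lemma continuous_laplace_kernel (mu : R) (c : C) (x : R) : 0 < x ->
  continuous (laplace_kernel mu c) x.
Proof.
intros Hx; apply (ex_derive_continuous (V := C_R_NormedModule)).
exists (RtoC (mu - 1) * laplace_kernel (mu - 1) c x - c * laplace_kernel (mu - 1 + 1) c x)%C.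
replace (laplace_kernel mu c) with (laplace_kernel (mu - 1 + 1) c) by (f_equal; ring).
now apply is_derive_laplace_kernel.
Qed.

Lemma laplace_kernel_at_infty (mu : R) (c : C) : 0 < Re c ->
  filterlim (laplace_kernel mu c) (Rbar_locally p_infty) (locally (RtoC 0)).
Proof.
intros Hc; apply (filterlim_Csqueeze _ _ (fun x => Rpower x (mu - 1) * exp (- (Re c * x))));
  [|now apply Rpower_exp_at_infty].
apply filter_forall; intros x; unfold laplace_kernel.
rewrite Cmod_mult, Cmod_R, Rabs_pos_eq, Cmod_Cexp by (left; apply exp_pos).
replace (Re (- (c * RtoC x))) with (- (Re c * x)) by (destruct c; simpl; ring).
apply Rle_refl.
Qed.

Lemma laplace_power_convergent (s : R) (c : C) : 0 < s -> 0 < Re c ->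
  regularized_integral limit_at_0 (laplace_kernel s c) (RtoC (Gamma_pos s) / Cpower c s)%C.
Proof.
intros Hs Hc; destruct (laplace_kernel_primitive s c Hs Hc) as (Phi & D & L0 & L1).
set (A := (RtoC (Gamma_pos s) / Cpower c s)%C) in *.
exists (fun x => A + - RtoC 1 * Phi x)%C; split; [split; [|split]|].
- intros x Hx; now apply continuous_laplace_kernel.
- intros x Hx; eapply is_derive_C_eq.
  + apply is_derive_C_plus; [apply is_derive_C_const|].
    apply is_derive_C_mult; [apply is_derive_C_const | now apply D].
  + cbv beta; ring.
- eapply filterlim_C_eq; [apply (filterlim_Cplus _); [apply filterlim_const|];
    apply (filterlim_Cmult _); [apply filterlim_const | exact L1]|]; ring.
- eapply filterlim_C_eq; [apply (filterlim_Cplus _); [apply filterlim_const|];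
    apply (filterlim_Cmult _); [apply filterlim_const | exact L0]|]; ring.
Qed.

Lemma Cpower_add1 (c : C) (x : R) : 0 < Re c -> Cpower c (x + 1) = (Cpower c x * c)%C.
Proof.
intros Hc; destruct (polar_form c Hc) as [Er Ei].
assert (E : c = (RtoC (Cmod c) * (cos (atan (Im c / Re c)), sin (atan (Im c / Re c))))%C).
{ rewrite (surjective_pairing c) at 1; change (fst c) with (Re c); change (snd c) with (Im c).
  apply injective_projections; simpl; rewrite ?Rmult_0_l; lra. }
transitivity (Cpower c x * (RtoC (Cmod c) * (cos (atan (Im c / Re c)), sin (atan (Im c / Re c)))))%C;
  [|now rewrite <- E].
clear E; unfold Cpower; set (th := atan (Im c / Re c)).
rewrite Rpower_plus, Rpower_1 by (now apply Cmod_gt_0_Re).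
replace ((x + 1) * th) with (x * th + th) by ring; rewrite cos_plus, sin_plus.
apply injective_projections; simpl; ring.
Qed.

Lemma poch_left (x : R) (n : nat) : poch x (S n) = x * poch (x + 1) n.
Proof.
induction n as [|n IH]; [simpl; ring|].
change (poch x (S n) * (x + INR (S n)) = x * (poch (x + 1) n * (x + 1 + INR n))).
rewrite IH, S_INR; ring.
Qed.

Lemma poch_neq_0 (x : R) (n : nat) : not_pole x -> poch x n <> 0.
Proof.
intros Hx; induction n as [|n IH]; simpl; [lra|].
apply Rmult_integral_contrapositive; split; [exact IH|].
intros E; apply (Hx n); lra.
Qed.

(** One integration by parts passes from the exponent [mu + 1] to [mu]; its
    boundary term has finite part zero, so the shift acts on finite parts by the
    functional equation of the Gamma function. *)
Lemma laplace_power_finite_part_aux (n : nat) (c : C) : 0 < Re c -> forall mu,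
  not_pole mu -> 0 < mu + INR n ->
  regularized_integral is_finite_part (laplace_kernel mu c)
    (RtoC (Gamma_pos (mu + INR n) / poch mu n) / Cpower c mu)%C.
Proof.
intros Hc; induction n as [|n IH]; intros mu Hmu Hn.
- simpl poch in *; simpl INR in *; rewrite Rplus_0_r in *.
  destruct (laplace_power_convergent mu c Hn Hc) as (J & HJ & HA).
  exists J; split; [exact HJ|]; apply is_finite_part_lim.
  now replace (Gamma_pos mu / 1) with (Gamma_pos mu) by field.
- assert (Hmu1 : not_pole (mu + 1)) by exact (not_pole_shift mu 1 Hmu).
  rewrite S_INR in *.
  destruct (IH (mu + 1) Hmu1 ltac:(lra)) as (J & (CJ & DJ & LJ) & HA).
  assert (Hmu0 : mu <> 0) by (intros E; apply (Hmu 0%nat); simpl; lra).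
  assert (Hmu0' : RtoC mu <> RtoC 0) by (now apply RtoC_neq_0).
  (* From (x^mu e^(-c x))' = mu x^(mu-1) e^(-c x) - c x^mu e^(-c x). *)
  exists (fun x => c / RtoC mu * J x + - / RtoC mu * laplace_kernel (mu + 1) c x)%C.
  destruct linear_finite_part as [fp_plus fp_mult]; split; [split; [|split]|].
  + intros x Hx; now apply continuous_laplace_kernel.
  + intros x Hx; eapply is_derive_C_eq.
    * exact (is_derive_C_plus _ _ _ _ _
        (is_derive_C_mult _ _ _ _ _ (is_derive_C_const (c / RtoC mu) x) (DJ x Hx))
        (is_derive_C_mult _ _ _ _ _ (is_derive_C_const (- / RtoC mu) x)
          (is_derive_laplace_kernel mu c x Hx))).
    * cbv beta; field; exact Hmu0'.
  + eapply filterlim_C_eq; [apply (filterlim_Cplus _)|].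
    * apply (filterlim_Cmult _); [apply filterlim_const | exact LJ].
    * apply (filterlim_Cmult _); [apply filterlim_const | now apply laplace_kernel_at_infty].
    * ring.
  + assert (HK : is_finite_part (laplace_kernel (mu + 1) c) (RtoC 0)).
    { unfold laplace_kernel; replace (mu + 1 - 1) with mu by ring.
      now apply is_finite_part_power_exp. }
    generalize (fp_plus _ _ _ _ (fp_mult (c / RtoC mu)%C _ _ HA) (fp_mult (- / RtoC mu)%C _ _ HK)).
    replace (mu + (INR n + 1)) with (mu + 1 + INR n) by ring.
    rewrite poch_left, Cpower_add1 by exact Hc.
    assert (Hp : poch (mu + 1) n <> 0) by now apply poch_neq_0.
    assert (Hc0 : c <> RtoC 0) by (intros ->; simpl in Hc; lra).
    pose proof (Cpower_neq_0 c mu).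
    match goal with |- is_finite_part _ ?A -> is_finite_part _ ?B => replace A with B; [easy|] end.
    rewrite !RtoC_div, RtoC_mult by (try apply Rmult_integral_contrapositive; auto).
    field; repeat split; trivial; now apply RtoC_neq_0.
Qed.

Lemma Gamma_shift_pos (x : R) : 0 < x + INR (Gamma_shift x).
Proof.
unfold Gamma_shift; destruct (archimed (- x)) as [H _].
rewrite INR_IZR_INZ.
assert (IZR (up (- x)) <= IZR (Z.of_nat (Z.to_nat (up (- x))))) by (apply IZR_le; lia); lra.
Qed.

Lemma laplace_power_finite_part (mu : R) (c : C) : 0 < Re c -> not_pole mu ->
  regularized_integral is_finite_part (laplace_kernel mu c) (RtoC (Gamma mu) / Cpower c mu)%C.
Proof.
intros Hc Hmu; unfold Gamma.
exact (laplace_power_finite_part_aux (Gamma_shift mu) c Hc mu Hmu (Gamma_shift_pos mu)).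
Qed.

Lemma Gamma_pos_eq (s : R) : 0 < s -> Gamma s = Gamma_pos s.
Proof.
intros Hs; unfold Gamma; replace (Gamma_shift s) with 0%nat.
- simpl; rewrite Rplus_0_r; field.
- unfold Gamma_shift; destruct (archimed (- s)) as [_ H].
  assert (up (- s) < 1)%Z by (apply lt_IZR; lra); lia.
Qed.

Lemma Gamma_neq_0 (mu : R) : not_pole mu -> Gamma mu <> 0.
Proof.
intros Hmu; unfold Gamma; apply Rmult_integral_contrapositive; split.
- apply Rgt_not_eq; exact (proj1 (Gamma_pos_primitive _ (Gamma_shift_pos mu))).
- apply Rinv_neq_0_compat; now apply poch_neq_0.
Qed.

(** * Summing the series *)

Lemma sum_n_C_ext (u w : nat -> C) (n : nat) :
  (forall j, (j <= n)%nat -> u j = w j) -> sum_n u n = sum_n w n :> C.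
Proof. intros H; now apply sum_n_ext_loc. Qed.

Lemma sum_n_Cplus (u w : nat -> C) (n : nat) :
  sum_n (fun j => u j + w j)%C n = (sum_n u n + sum_n w n)%C :> C.
Proof. exact (sum_n_plus (G := C_AbelianGroup) u w n). Qed.

Lemma sum_n_C_Sn (u : nat -> C) (n : nat) : sum_n u (S n) = (sum_n u n + u (S n))%C :> C.
Proof. exact (sum_Sn u n). Qed.

Lemma sum_n_C_first (u : nat -> C) (n : nat) :
  sum_n u (S n) = (u 0%nat + sum_n (fun j => u (S j)) n)%C :> C.
Proof.
induction n as [|n IH].
- now rewrite sum_n_C_Sn, !sum_O.
- rewrite sum_n_C_Sn, IH, sum_n_C_Sn; ring.
Qed.

(** The coefficient of X^s in (1 - X)^m. *)
Definition neg_binom (m s : nat) : R := poch (- INR m) s / INR (fact s).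

(** Pascal's rule, as [neg_binom m s] is (-1)^s times a binomial coefficient. *)
Lemma neg_binom_pascal (m s : nat) :
  neg_binom (S m) (S s) = neg_binom m (S s) - neg_binom m s.
Proof.
unfold neg_binom; rewrite poch_left, S_INR, fact_simpl, mult_INR, S_INR.
replace (- (INR m + 1) + 1) with (- INR m) by ring.
change (poch (- INR m) (S s)) with (poch (- INR m) s * (- INR m + INR s)).
pose proof (INR_fact_neq_0 s); pose proof (pos_INR s); field; lra.
Qed.

Lemma neg_binom_0 (m : nat) : neg_binom m 0 = 1.
Proof. unfold neg_binom; simpl; field. Qed.

Lemma neg_binom_above (m : nat) : neg_binom m (S m) = 0.
Proof. unfold neg_binom; simpl poch; replace (- INR m + INR m) with 0 by ring; unfold Rdiv; ring. Qed.

Lemma neg_binom_sum (X : C) (m : nat) :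
  sum_n (fun s => RtoC (neg_binom m s) * X ^ s)%C m = ((1 - X) ^ m)%C :> C.
Proof.
induction m as [|m IH].
- rewrite sum_O, neg_binom_0; simpl; ring.
- rewrite sum_n_C_first, neg_binom_0.
  rewrite (sum_n_C_ext _ (fun s => RtoC (neg_binom m (S s)) * X ^ S s
    + - X * (RtoC (neg_binom m s) * X ^ s))%C).
  2:{ intros s _; rewrite neg_binom_pascal, RtoC_minus, Cpow_S; ring. }
  rewrite sum_n_Cplus, sum_n_Cmult, IH.
  assert (E := sum_n_C_first (fun s => RtoC (neg_binom m s) * X ^ s)%C m).
  rewrite sum_n_C_Sn, IH, neg_binom_above, neg_binom_0 in E.
  rewrite Cpow_S.
  match goal with |- (_ + (?S + _))%C = _ =>
    replace S with ((1 - X) ^ m - 1)%C; [simpl; ring|] end.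
  match type of E with _ = (_ + ?S)%C => replace S with (RtoC 1 * X ^ 0 + S - 1)%C by (simpl; ring) end.
  rewrite <- E; ring.
Qed.

Lemma poch_add (x : R) (l s : nat) : poch x (l + s) = poch x l * poch (x + INR l) s.
Proof.
induction s as [|s IH]; [rewrite Nat.add_0_r; simpl; ring|].
rewrite Nat.add_succ_r; simpl poch; rewrite IH, plus_INR; ring.
Qed.

Lemma Cpower_add_nat (c : C) (x : R) (n : nat) : 0 < Re c ->
  Cpower c (x + INR n) = (Cpower c x * c ^ n)%C.
Proof.
intros Hc; induction n as [|n IH].
- simpl; rewrite Rplus_0_r; ring.
- rewrite S_INR, <- Rplus_assoc, Cpower_add1, IH, Cpow_S by exact Hc; ring.
Qed.

Lemma Re_pos_neq_0 (c : C) : 0 < Re c -> c <> RtoC 0.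
Proof. intros Hc ->; simpl in Hc; lra. Qed.

Lemma sign_square (n : nat) : ((- (1)) ^ n * (- (1)) ^ n)%C = RtoC 1.
Proof.
rewrite <- Cpow_mult_l; replace (- (1) * - (1))%C with (RtoC 1) by ring; apply Cpow_1_l.
Qed.

(** For Y = (w2^v - b^v) / b^v and u = w1 / a, the sum over s is (-Y)^(k-l);
    the sign (-1)^k absorbs those of -u and -Y. *)
Lemma resummed_term (Y u : C) (k l : nat) : Y <> RtoC 0 -> (l <= k)%nat ->
  ((- (1)) ^ k * (- u) ^ l * (- Y) ^ (k - l) = Y ^ k * (u / Y) ^ l)%C.
Proof.
intros HY Hl; unfold Cdiv.
replace (- u)%C with (- (1) * u)%C by ring; replace (- Y)%C with (- (1) * Y)%C by ring.
rewrite !Cpow_mult_l, Cpow_inv by exact HY.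
replace k with (k - l + l)%nat at 1 4 by lia; rewrite !Cpow_add_r.
pose proof (Cpow_nz _ l HY).
transitivity (((- (1)) ^ (k - l) * (- (1)) ^ (k - l)) * ((- (1)) ^ l * (- (1)) ^ l) * (u ^ l * Y ^ (k - l)))%C;
  [ring|].
rewrite !sign_square; field; assumption.
Qed.

(** * Integration of the polynomials *)

Definition KM_coef (k v : nat) (p q : R) (w1 w2 : C) (l s : nat) : C :=
  (RtoC ((-1) ^ k * Gamma (INR k + q + 1)) *
   RtoC (poch (- INR k) (l + s) * poch (INR k + 1 - p) l /
     (Gamma (INR l + q + 1) * Gamma (INR (v * s) - p - q + 1) * INR (fact l) * INR (fact s))) *
   (- w1) ^ l * w2 ^ (v * s))%C.

Definition laplace_value (k v : nat) (p q : R) (w1 w2 a b : C) : C :=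
  (RtoC (Gamma (INR k + q + 1)) / (Cpower a (q + 1) * Cpower b (1 - p - q))
   * ((w2 ^ v - b ^ v) / b ^ v) ^ k
   * hyp2F0 k (INR k + 1 - p) (w1 * b ^ v / (a * (w2 ^ v - b ^ v))))%C.

Lemma integrand_expansion (k v : nat) (p q : R) (w1 w2 a b : C) (y z : R) : 0 < y -> 0 < z ->
  (Cexp (- (a * RtoC y + b * RtoC z)) * (RtoC (Rpower y q * Rpower z (- p - q))
     * KM k v p q (w1 * RtoC y) (w2 * RtoC z)))%C
  = sum_n (fun l => sum_n (fun s => (KM_coef k v p q w1 w2 l s
      * laplace_kernel (INR (v * s) - p - q + 1) b z)
      * laplace_kernel (INR l + q + 1) a y)%C (k - l)) k.
Proof.
intros Hy Hz; unfold KM.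
rewrite !Cmult_assoc, <- sum_n_Cmult; apply sum_n_C_ext; intros l _.
rewrite <- sum_n_Cmult; apply sum_n_C_ext; intros s _.
unfold KM_coef, laplace_kernel.
replace (INR l + q + 1 - 1) with (q + INR l) by ring.
replace (INR (v * s) - p - q + 1 - 1) with (- p - q + INR (v * s)) by ring.
rewrite !Rpower_plus, !Rpower_pow by trivial.
replace (- (a * RtoC y + b * RtoC z))%C with (- (a * RtoC y) + - (b * RtoC z))%C by ring.
rewrite Cexp_plus.
replace (- (w1 * RtoC y))%C with (- w1 * RtoC y)%C by ring.
rewrite !Cpow_mult_l, <- !RtoC_pow, !(RtoC_mult (Rpower _ _)); ring.
Qed.

Lemma not_pole_pos (s : R) : 0 < s -> not_pole s.
Proof. intros Hs n E; pose proof (pos_INR n); lra. Qed.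

Lemma laplace_value_expansion (k v : nat) (p q : R) (w1 w2 a b : C) :
  -1 < q -> 0 < Re a -> 0 < Re b -> (w2 ^ v)%C <> (b ^ v)%C ->
  (forall s, (s <= k)%nat -> not_pole (INR (v * s) - p - q + 1)) ->
  sum_n (fun l => sum_n (fun s => KM_coef k v p q w1 w2 l s
      * (RtoC (Gamma (INR l + q + 1)) / Cpower a (INR l + q + 1))
      * (RtoC (Gamma (INR (v * s) - p - q + 1)) / Cpower b (INR (v * s) - p - q + 1)))%C (k - l)) k
  = laplace_value k v p q w1 w2 a b :> C.
Proof.
intros Hq Ha Hb Hw Hpole.
pose proof (Re_pos_neq_0 a Ha) as Ha0; pose proof (Re_pos_neq_0 b Hb) as Hb0.
pose proof (Cpow_nz b v Hb0) as HB.
pose proof (Cpower_neq_0 a (q + 1)) as HA; pose proof (Cpower_neq_0 b (1 - p - q)) as HBp.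
assert (HD : (w2 ^ v - b ^ v)%C <> RtoC 0).
{ intros E; apply Hw; replace (w2 ^ v)%C with (w2 ^ v - b ^ v + b ^ v)%C by ring.
  rewrite E; ring. }
set (Y := ((w2 ^ v - b ^ v) / b ^ v)%C).
assert (HY : Y <> RtoC 0).
{ unfold Y; intros E; apply HD.
  replace (w2 ^ v - b ^ v)%C with ((w2 ^ v - b ^ v) / b ^ v * b ^ v)%C by (field; exact HB).
  rewrite E; ring. }
unfold laplace_value, hyp2F0; rewrite <- sum_n_Cmult; apply sum_n_C_ext; intros l Hl.
fold Y; replace (w1 * b ^ v / (a * (w2 ^ v - b ^ v)))%C with ((w1 / a) / Y)%C
  by (unfold Y; field; auto).
set (G := Gamma (INR k + q + 1)).
set (cl := poch (- INR k) l * poch (INR k + 1 - p) l / INR (fact l)).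
rewrite (sum_n_C_ext _ (fun s =>
  (RtoC G / (Cpower a (q + 1) * Cpower b (1 - p - q)) * RtoC cl * ((- (1)) ^ k * (- (w1 / a)) ^ l))
  * (RtoC (neg_binom (k - l) s) * (w2 ^ v / b ^ v) ^ s))%C).
- rewrite sum_n_Cmult, neg_binom_sum.
  replace (1 - w2 ^ v / b ^ v)%C with (- Y)%C by (unfold Y; field; exact HB).
  transitivity (RtoC G / (Cpower a (q + 1) * Cpower b (1 - p - q)) * RtoC cl
    * ((- (1)) ^ k * (- (w1 / a)) ^ l * (- Y) ^ (k - l)))%C; [ring|].
  rewrite resummed_term by assumption; ring.
- intros s Hs; unfold KM_coef; fold G.
  assert (HGl : Gamma (INR l + q + 1) <> 0)
    by (apply Gamma_neq_0, not_pole_pos; pose proof (pos_INR l); lra).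
  assert (HGs : Gamma (INR (v * s) - p - q + 1) <> 0) by (apply Gamma_neq_0, Hpole; lia).
  replace (Cpower a (INR l + q + 1)) with (Cpower a (q + 1) * a ^ l)%C
    by (rewrite <- Cpower_add_nat by exact Ha; f_equal; ring).
  replace (Cpower b (INR (v * s) - p - q + 1)) with (Cpower b (1 - p - q) * (b ^ v) ^ s)%C
    by (rewrite <- Cpow_mult_r, <- Cpower_add_nat by exact Hb; f_equal; ring).
  replace (- (w1 / a))%C with (- w1 / a)%C by (field; exact Ha0).
  rewrite Cpow_mult_r; unfold Cdiv.
  rewrite !Cpow_mult_l, !Cpow_inv by assumption.
  unfold neg_binom; rewrite minus_INR by exact Hl.
  replace (- (INR k - INR l)) with (- INR k + INR l) by ring.
  rewrite poch_add; unfold cl.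
  pose proof (Cpow_nz a l Ha0); pose proof (Cpow_nz _ s HB).
  pose proof (INR_fact_neq_0 l); pose proof (INR_fact_neq_0 s).
  rewrite RtoC_mult, RtoC_pow.
  replace (RtoC (-1)) with (- (1))%C by (apply injective_projections; simpl; ring).
  set (Gl := Gamma (INR l + q + 1)) in *; set (Gs := Gamma (INR (v * s) - p - q + 1)) in *.
  replace (RtoC (poch (- INR k) l * poch (- INR k + INR l) s * poch (INR k + 1 - p) l
    / (Gl * Gs * INR (fact l) * INR (fact s)))) with
    (RtoC (poch (- INR k) l * poch (INR k + 1 - p) l / INR (fact l))
     * RtoC (poch (- INR k + INR l) s / INR (fact s)) / (RtoC Gl * RtoC Gs))%C.
  + field; repeat split; trivial; now apply RtoC_neq_0.
  + rewrite <- !RtoC_mult, <- RtoC_div.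
    * f_equal; field; auto.
    * now apply Rmult_integral_contrapositive.
Qed.

Lemma is_laplace2_KM (k v : nat) (p q : R) (w1 w2 a b : C) :
  -1 < q -> 0 < Re a -> 0 < Re b -> (w2 ^ v)%C <> (b ^ v)%C ->
  (forall s, (s <= k)%nat -> not_pole (INR (v * s) - p - q + 1)) ->
  is_laplace2 (fun y z => RtoC (Rpower y q * Rpower z (- p - q))
     * KM k v p q (w1 * RtoC y) (w2 * RtoC z))%C a b (laplace_value k v p q w1 w2 a b).
Proof.
intros Hq Ha Hb Hw Hpole.
set (Ga := fun l => (RtoC (Gamma (INR l + q + 1)) / Cpower a (INR l + q + 1))%C).
apply (is_laplace2_intro _ _ _ _ (fun z => sum_n (fun l => sum_n (fun s =>
  KM_coef k v p q w1 w2 l s * laplace_kernel (INR (v * s) - p - q + 1) b z * Ga l)%C (k - l)) k)).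
- intros z Hz.
  eapply regularized_ext; [intros y Hy; symmetry; now apply integrand_expansion|].
  apply (regularized_sum _ linear_limit_at_0 _ _ k); intros l Hl.
  apply (regularized_sum _ linear_limit_at_0 _ _ (k - l)); intros s Hs.
  apply (regularized_Cmult _ linear_limit_at_0).
  assert (0 < INR l + q + 1) by (pose proof (pos_INR l); lra).
  unfold Ga; rewrite Gamma_pos_eq by assumption; now apply laplace_power_convergent.
- rewrite <- laplace_value_expansion by assumption.
  apply (regularized_sum _ linear_finite_part _ _ k); intros l Hl.
  apply (regularized_sum _ linear_finite_part _ _ (k - l)); intros s Hs.
  apply regularized_ext with (fun z => KM_coef k v p q w1 w2 l s * Ga l
    * laplace_kernel (INR (v * s) - p - q + 1) b z)%C; [intros z _; ring|].
  apply (regularized_Cmult _ linear_finite_part), laplace_power_finite_part; [exact Hb|].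
  apply Hpole; lia.
Qed.

(** * Continuity in the parameter *)

(** With m = [up t], m - 1 <= t < m: if t = m - 1, a radius of 1 leaves no
    integer but [t] itself, which is punctured; otherwise no integer lies strictly
    between m - 1 and m. *)
Lemma punctured_not_nat (t : R) : locally' t (fun t' => forall n : nat, t' <> INR n).
Proof.
destruct (archimed t) as [H1 H2]; set (m := up t) in *.
assert (key : exists d : posreal, forall t', Rabs (t' - t) < d -> t' <> t ->
  (IZR m - 2 < t' < IZR m /\ t' <> IZR m - 1)).
{ destruct (Req_dec t (IZR m - 1)) as [E|E].
  - exists (mkposreal 1 Rlt_0_1); intros t' Ht Hn; apply Rabs_def2 in Ht; simpl in Ht; lra.
  - assert (Hd : 0 < Rmin (t - (IZR m - 1)) (IZR m - t)) by (apply Rmin_glb_lt; lra).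
    exists (mkposreal _ Hd); intros t' Ht Hn; apply Rabs_def2 in Ht; simpl in Ht.
    pose proof (Rmin_l (t - (IZR m - 1)) (IZR m - t)).
    pose proof (Rmin_r (t - (IZR m - 1)) (IZR m - t)); lra. }
destruct key as [d Hd]; exists d; intros t' Ht Hn n E.
destruct (Hd t' Ht Hn) as [H3 H4]; rewrite E, INR_IZR_INZ in *.
rewrite <- minus_IZR in *.
assert (m - 2 < Z.of_nat n)%Z by (apply lt_IZR; lra).
assert (Z.of_nat n < m)%Z by (apply lt_IZR; lra).
apply H4; f_equal; lia.
Qed.

Lemma punctured_not_pole (k v : nat) (p q : R) :
  locally' p (fun p' => forall s, (s <= k)%nat -> not_pole (INR (v * s) - p' - q + 1)).
Proof.
assert (one : forall s, locally' p (fun p' => not_pole (INR (v * s) - p' - q + 1))).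
{ intros s; set (c := INR (v * s) - q + 1).
  destruct (punctured_not_nat (p - c)) as [d Hd]; exists d; intros p' Hp Hn n E.
  apply (Hd (p' - c)) with n; [|lra|unfold c; lra].
  change (Rabs (p' - c - (p - c)) < d); replace (p' - c - (p - c)) with (p' - p) by ring; exact Hp. }
induction k as [|k IH].
- generalize (one 0%nat); apply filter_imp; intros p' H s Hs; now replace s with 0%nat by lia.
- generalize (filter_and _ _ IH (one (S k))); apply filter_imp; intros p' [H1 H2] s Hs.
  destruct (Nat.eq_dec s (S k)) as [->|]; [exact H2 | apply H1; lia].
Qed.

Lemma poch_lim (F : (R -> Prop) -> Prop) {FF : Filter F} (p : R)
  (c : R) (l : nat) :
  filterlim (fun t => t) F (locally p) ->
  filterlim (fun t => poch (c - t) l) F (locally (poch (c - p) l)).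
Proof.
intros Fp; induction l as [|l IH]; simpl; [apply filterlim_const|].
apply (filterlim_Rmult F); [exact IH|].
apply (filterlim_Rplus F); [|apply filterlim_const].
apply (filterlim_Rplus F); [apply filterlim_const|]; now apply (filterlim_Ropp F).
Qed.

Lemma hyp2F0_lim (F : (R -> Prop) -> Prop) {FF : Filter F} (p : R)
  (k : nat) (c : R) (x : C) :
  filterlim (fun t => t) F (locally p) ->
  filterlim (fun t => hyp2F0 k (c - t) x) F (locally (hyp2F0 k (c - p) x)).
Proof.
intros Fp.
assert (sum_lim : forall (u : nat -> R -> C) (L : nat -> C) n,
  (forall l, filterlim (u l) F (locally (L l))) ->
  filterlim (fun t => sum_n (fun l => u l t) n) F (locally (sum_n L n))).
{ intros u L n H; induction n as [|n IH].
  - rewrite sum_O; apply (filterlim_ext (u 0%nat)); [intros t; now rewrite sum_O | apply H].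
  - rewrite sum_n_C_Sn; apply (filterlim_ext (fun t => sum_n (fun l => u l t) n + u (S n) t)%C).
    + intros t; now rewrite sum_n_C_Sn.
    + now apply (filterlim_Cplus F). }
unfold hyp2F0; apply (sum_lim (fun l t => _)); intros l.
apply (filterlim_Cmult F); [|apply filterlim_const].
apply (filterlim_R_eqC F); apply (filterlim_Rmult F); [|apply filterlim_const].
apply (filterlim_Rmult F); [apply filterlim_const | now apply (poch_lim F)].
Qed.

Lemma Cpower_lim (F : (R -> Prop) -> Prop) {FF : Filter F} (p : R)
  (c : C) (d : R) :
  filterlim (fun t => t) F (locally p) ->
  filterlim (fun t => Cpower c (t + d)) F (locally (Cpower c (p + d))).
Proof.
intros Fp.
apply (filterlim_comp _ _ _ (fun t => t) (fun t => Cpower c (t + d)) F (locally p)); [exact Fp|].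
assert (K : forall g : R -> R, ex_derive g p -> filterlim g (locally p) (locally (g p)))
  by exact (fun g => ex_derive_continuous (V := R_NormedModule) g p).
apply (filterlim_Cmult (locally p)).
- apply (filterlim_R_eqC (locally p)), (K (fun t => Rpower (Cmod c) (t + d))).
  unfold Rpower; now auto_derive.
- apply (filterlim_C (locally p)); split.
  + apply (K (fun t => cos ((t + d) * atan (Im c / Re c)))); now auto_derive.
  + apply (K (fun t => sin ((t + d) * atan (Im c / Re c)))); now auto_derive.
Qed.

Lemma laplace_value_lim (k v : nat) (p q : R) (w1 w2 a b : C) :
  filterlim (fun t => laplace_value k v t q w1 w2 a b) (locally' p)
    (locally (laplace_value k v p q w1 w2 a b)).
Proof.
assert (FF : Filter (locally' p)) by apply within_filter, locally_filter.
assert (Fp : filterlim (fun t => t) (locally' p) (locally p)).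
{ intros P [eps HP]; exists eps; intros x Hx _; exact (HP x Hx). }
unfold laplace_value.
apply (filterlim_Cmult _); [|now apply (hyp2F0_lim _)].
apply (filterlim_Cmult _); [|apply filterlim_const].
assert (E : forall t, (RtoC (Gamma (INR k + q + 1)) / (Cpower a (q + 1) * Cpower b (1 - t - q))
  = RtoC (Gamma (INR k + q + 1)) / Cpower a (q + 1) * Cpower b (t + (q - 1)))%C).
{ intros t; replace (t + (q - 1)) with (- (1 - t - q)) by ring; rewrite <- Cpower_inv.
  field; split; apply Cpower_neq_0. }
apply (filterlim_ext (fun t => RtoC (Gamma (INR k + q + 1)) / Cpower a (q + 1) * Cpower b (t + (q - 1)))%C).
{ intros t; now rewrite E. }
rewrite E; apply (filterlim_Cmult _); [apply filterlim_const | now apply (Cpower_lim _)].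
Qed.

Theorem theorem18 (k v : nat) (p q : R) (w1 w2 a b : C)
  (hp : 2 * INR k + 1 < p) (hq : -1 < q) (hv : (1 <= v)%nat)
  (ha : 0 < Re a) (hb : 0 < Re b)
  (hw : (w2 ^ v)%C <> (b ^ v)%C) :
  let f (p' y z : R) : C :=
    (RtoC (Rpower y q * Rpower z (- p' - q))
     * KM k v p' q (w1 * RtoC y) (w2 * RtoC z))%C in
  let rhs : C :=
    (RtoC (Gamma (INR k + q + 1)) / (Cpower a (q + 1) * Cpower b (1 - p - q))
     * ((w2 ^ v - b ^ v) / b ^ v) ^ k
     * hyp2F0 k (INR k + 1 - p) (w1 * b ^ v / (a * (w2 ^ v - b ^ v))))%C in
  ((forall s n : nat, (s <= k)%nat -> INR (v * s) - p - q + 1 <> - INR n) ->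
   is_laplace2 (f p) a b rhs)
  /\
  (exists L : R -> C,
     locally' p (fun p' => is_laplace2 (f p') a b (L p')) /\
     filterlim L (locally' p) (locally rhs)).
Proof.
intros f rhs; split.
- intros Hpole; apply is_laplace2_KM; trivial; intros s Hs n; now apply Hpole.
- exists (fun p' => laplace_value k v p' q w1 w2 a b); split; [|apply laplace_value_lim].
  generalize (punctured_not_pole k v p q); apply filter_imp; intros p' Hpole.
  now apply is_laplace2_KM.
Qed.
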